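(* There exists a connected solvable non-nilpotent real Lie group that is not Diophantine.
   Context: Let $G$ be a connected real Lie group with a left-invariant Riemannian metric $d$. For a subgroup $\Gamma=\langle S\rangle$ with finite generating set $S$, let $B_\Gamma(n)=(S\cup S^{-1}\cup\{1\})^n$ and $\delta_\Gamma(n)=\min\{d(x,1): x\in B_\Gamma(n),\ x\ne 1\}$ ($+\infty$ if there is no such $x$). For $\beta>0$, $\Gamma=\langle S\rangle$ is $\beta$-Diophantine if there is $c>0$ such that $\delta_\Gamma(n)\ge c\,|B_\Gamma(n)|^{-\beta}$ for all $n\ge 1$. $G$ is Diophantine for $k$-tuples if there is $\beta=\beta(k)>0$ such that almost every $k$-tuple in $G^k$ (for Haar measure on $G^k$) generates a $\beta$-Diophantine subgroup, the $k$-tuple being taken as generating set $S$. $G$ is Diophantine if it is Diophantine for $k$-tuples for every integer $k\ge 1$. *)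

(* Defs.v *)
From HB Require Import structures.
From mathcomp Require Import all_boot all_order all_algebra.
From mathcomp Require Import finmap.
From mathcomp Require Import all_classical all_reals all_analysis.

Set Implicit Arguments.
Unset Strict Implicit.
Unset Printing Implicit Defensive.

Import Order.TTheory GRing.Theory Num.Theory.
Import numFieldNormedType.Exports.

Local Open Scope classical_set_scope.
Local Open Scope ring_scope.

(* [Cn n U f] : f is of class C^n on the open subset U of V.  Testing the
   differential on each fixed vector is the usual definition when V is
   finite-dimensional, the only case in which it is used. *)
Fixpoint Cn (R : realType) (V W : normedModType R) (n : nat) (U : set V)
    (f : V -> W) : Prop :=
  if n is n'.+1 then
    (forall x, U x -> differentiable f x) /\
    (forall v, Cn n' U (fun x => 'd f x v))
  else forall x, U x -> {for x, continuous f}.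

Definition smooth (R : realType) (V W : normedModType R) (U : set V)
    (f : V -> W) : Prop := forall n, Cn n U f.

#[short(type="groupTopologicalType")]
HB.structure Definition GroupTopological :=
  {G of Group G & PointedTopological G}.

HB.mixin Record isTopologicalGroup G of GroupTopological G := {
  mulg_continuous : continuous (fun z : G * G => (z.1 * z.2)%g);
  invg_continuous : continuous (fun x : G => (x^-1)%g)
}.

#[short(type="topologicalGroupType")]
HB.structure Definition TopologicalGroup :=
  {G of isTopologicalGroup G & GroupTopological G}.

(* [chart_map] and [chart_inv] are total functions, meaningful only on
   [chart_dom] and on its image [chart_im] respectively. *)
Record chart (R : realType) (G : topologicalType) (n : nat) := Chart {
  chart_dom : set G;
  chart_map :> G -> 'rV[R]_n;
  chart_inv : 'rV[R]_n -> G;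
  chart_dom_open : open chart_dom;
  chart_im_open : open (chart_map @` chart_dom);
  chart_mapK : forall x, chart_dom x -> chart_inv (chart_map x) = x;
  chart_map_continuous :
    forall x, chart_dom x -> {for x, continuous chart_map};
  chart_inv_continuous :
    forall p, (chart_map @` chart_dom) p -> {for p, continuous chart_inv}
}.

Definition chart_im (R : realType) (G : topologicalType) (n : nat)
  (c : chart R G n) : set 'rV[R]_n := c @` chart_dom c.

HB.mixin Record isLieGroup (R : realType) G of TopologicalGroup G := {
  lie_dim : nat;
  lie_atlas : set (chart R G lie_dim);
  lie_hausdorff : hausdorff_space G;
  lie_second_countable : @second_countable G;
  lie_atlas_cover : forall x : G, exists2 c, lie_atlas c & chart_dom c x;
  lie_atlas_compatible : forall c c', lie_atlas c -> lie_atlas c' ->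
    smooth (c @` (chart_dom c `&` chart_dom c')) (c' \o chart_inv c);
  lie_mul_smooth : forall c1 c2 c3,
    lie_atlas c1 -> lie_atlas c2 -> lie_atlas c3 ->
    smooth [set p : 'rV[R]_lie_dim * 'rV[R]_lie_dim |
             [/\ chart_im c1 p.1, chart_im c2 p.2 &
                 chart_dom c3 (chart_inv c1 p.1 * chart_inv c2 p.2)%g]]
           (fun p => c3 (chart_inv c1 p.1 * chart_inv c2 p.2)%g);
  lie_inv_smooth : forall c1 c2, lie_atlas c1 -> lie_atlas c2 ->
    smooth [set p : 'rV[R]_lie_dim |
             chart_im c1 p /\ chart_dom c2 ((chart_inv c1 p)^-1)%g]
           (fun p => c2 ((chart_inv c1 p)^-1)%g)
}.

#[short(type="lieGroupType")]
HB.structure Definition LieGroup (R : realType) :=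
  {G of isLieGroup R G & TopologicalGroup G}.

Arguments lie_dim {R} s.
Arguments lie_atlas {R} s.

Section RiemannianMetric.
Context {R : realType} (G : lieGroupType R).
Local Notation n := (lie_dim G).

Definition bilin (A : 'M[R]_n) (u v : 'rV[R]_n) : R := (u *m A *m v^T) 0 0.

(* Expression in charts of the left translation by h; for h = 1 this is the
   transition map from c to c'. *)
Definition chart_translation (h : G) (c c' : chart R G n)
  : 'rV[R]_n -> 'rV[R]_n := fun p => c' (h * chart_inv c p)%g.

(* Left translation by h, read from c to c' near x, preserves the scalar
   products whose Gram matrices in the charts are given by [gram]. *)
Definition translation_isometric_at (gram : chart R G n -> 'rV[R]_n -> 'M[R]_n)
    (h : G) (c c' : chart R G n) (x : G) : Prop :=
  forall u v : 'rV[R]_n,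
    bilin (gram c' (c' (h * x)%g))
      ('d (chart_translation h c c') (c x) u)
      ('d (chart_translation h c c') (c x) v)
    = bilin (gram c (c x)) u v.

(* [gram c p] is the Gram matrix of the metric at the point of coordinates p
   in the basis of coordinate vectors of c. *)
Record riemannian_metric := RiemannianMetric {
  gram : chart R G n -> 'rV[R]_n -> 'M[R]_n;
  gram_smooth : forall c, lie_atlas G c -> smooth (chart_im c) (gram c);
  gram_sym : forall c p, lie_atlas G c -> chart_im c p ->
    (gram c p)^T = gram c p;
  gram_gt0 : forall c p u, lie_atlas G c -> chart_im c p -> u != 0 ->
    0 < bilin (gram c p) u u;
  gram_compatible : forall c c' x, lie_atlas G c -> lie_atlas G c' ->
    chart_dom c x -> chart_dom c' x ->
    translation_isometric_at gram 1%g c c' x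
}.

Definition left_invariant (g : riemannian_metric) : Prop :=
  forall h c c' x, lie_atlas G c -> lie_atlas G c' ->
    chart_dom c x -> chart_dom c' (h * x)%g ->
    translation_isometric_at (gram g) h c c' x.

(* Only the restriction to [0, 1] matters for lengths, and every C^1 curve on
   [0, 1] extends to a C^1 curve on the whole line. *)
Definition C1_curve (gamma : R -> G) : Prop :=
  continuous gamma /\
  forall c, lie_atlas G c ->
    Cn 1 [set t : R^o | chart_dom c (gamma t)] (c \o gamma).

Definition is_speed (g : riemannian_metric) (gamma : R -> G) (s : R -> R) :=
  forall t c, lie_atlas G c -> chart_dom c (gamma t) ->
    s t = Num.sqrt (bilin (gram g c (c (gamma t)))
                      (derive1 (c \o gamma) t) (derive1 (c \o gamma) t)).

Definition curve_lengths (g : riemannian_metric) (x y : G) : set (\bar R) :=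
  [set L | exists gamma s,
    [/\ C1_curve gamma, gamma 0 = x, gamma 1 = y, is_speed g gamma s &
        L = (\int[lebesgue_measure]_(t in `[0%R, 1%R]) (s t)%:E)%E]].

Definition riemannian_dist (g : riemannian_metric) (x y : G) : \bar R :=
  ereal_inf (curve_lengths g x y).

End RiemannianMetric.

Section AbstractGroup.
Context (G : groupType).

Definition generated (A : set G) : set G :=
  smallest (fun H : set G => group_closed (mem H)) A.

Definition commutators (A B : set G) : set G :=
  generated [set commg a b | a in A & b in B].

Fixpoint derived_series (n : nat) : set G :=
  if n is n'.+1 then commutators (derived_series n') (derived_series n')
  else setT.

Fixpoint lower_central_series (n : nat) : set G :=
  if n is n'.+1 then commutators (lower_central_series n') setT else setT.

Definition group_solvable : Prop :=
  exists n, derived_series n = [set 1%g].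

Definition group_nilpotent : Prop :=
  exists n, lower_central_series n = [set 1%g].

Definition letters (S : set G) : set G :=
  S `|` [set (x^-1)%g | x in S] `|` [set 1%g].

Fixpoint word_ball (S : set G) (n : nat) : set G :=
  if n is n'.+1 then [set (x * y)%g | x in word_ball S n' & y in letters S]
  else [set 1%g].

End AbstractGroup.

Definition gpow (G : Type) (k : nat) : Type := {ptws 'I_k -> G}.

HB.instance Definition _ (G : topologicalType) (k : nat) :=
  Topological.copy (gpow G k) {ptws 'I_k -> G}.

Section GroupPower.
Context (G : groupTopologicalType) (k : nat).

Definition gpow_one : gpow G k := fun=> 1%g.
Definition gpow_inv (x : gpow G k) : gpow G k := fun i => ((x i)^-1)%g.
Definition gpow_mul (x y : gpow G k) : gpow G k := fun i => (x i * y i)%g.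

Lemma gpow_mulA : associative gpow_mul.
Proof. by move=> x y z; apply/funext => i; exact: mulgA. Qed.
Lemma gpow_mul1 : left_id gpow_one gpow_mul.
Proof. by move=> x; apply/funext => i; exact: mul1g. Qed.
Lemma gpow_mulr1 : right_id gpow_one gpow_mul.
Proof. by move=> x; apply/funext => i; exact: mulg1. Qed.
Lemma gpow_mulV : left_inverse gpow_one gpow_inv gpow_mul.
Proof. by move=> x; apply/funext => i; exact: mulVg. Qed.
Lemma gpow_mulrV : right_inverse gpow_one gpow_inv gpow_mul.
Proof. by move=> x; apply/funext => i; exact: mulgV. Qed.

HB.instance Definition _ := isPointed.Build (gpow G k) gpow_one.
HB.instance Definition _ := isGroup.Build (gpow G k)
  gpow_mulA gpow_mul1 gpow_mulr1 gpow_mulV gpow_mulrV.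

End GroupPower.

Definition borel (T : ptopologicalType) := g_sigma_algebraType (@open T).
HB.instance Definition _ (T : ptopologicalType) := Measurable.on (borel T).

(* On a second countable locally compact Hausdorff group, regularity is
   automatic. *)
Definition haar_measure (R : realType) (H : groupTopologicalType)
    (mu : {measure set (borel H) -> \bar R}) : Prop :=
  [/\ forall (h : H) (A : set (borel H)), measurable A ->
        mu [set (h * x : H)%g | x in A] = mu A,
      forall K : set H, compact K -> (mu K < +oo)%E &
      forall U : set H, open U -> U !=set0 -> (0 < mu U)%E].

Section Diophantine.
Context {R : realType} (G : lieGroupType R) (g : riemannian_metric G).

(* The empty infimum is +oo. *)
Definition delta (S : set G) (n : nat) : \bar R :=
  ereal_inf [set riemannian_dist g x 1%g | x in word_ball S n `\ 1%g].

Definition beta_diophantine (beta : R) (S : set G) : Prop :=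
  exists2 c : R, 0 < c & forall n, (1 <= n)%N ->
    ((c * (#|` fset_set (word_ball S n)|%fset%:R `^ (- beta)))%:E
      <= delta S n)%E.

Definition diophantine_for (k : nat) : Prop :=
  exists2 beta : R, 0 < beta &
    forall mu : {measure set (borel (gpow G k)) -> \bar R},
      haar_measure mu ->
      {ae mu, forall x : gpow G k, beta_diophantine beta (range x)}.

Definition diophantine : Prop :=
  forall k, (1 <= k)%N -> diophantine_for k.

End Diophantine.

(* Main.v *)
Require Import Defs.
From HB Require Import structures.
From mathcomp Require Import all_boot all_order all_algebra.
From mathcomp Require Import all_classical all_reals all_analysis.
From mathcomp Require Import measurable_realfun.
From mathcomp Require Import finmap ring lra zify.

Set Implicit Arguments.
Unset Strict Implicit.
Unset Printing Implicit Defensive.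
Import Order.TTheory GRing.Theory Num.Theory.
Import numFieldNormedType.Exports.
Local Open Scope classical_set_scope.
Local Open Scope ring_scope.

(** The group is the semidirect product of the Heisenberg group by the line,
    where [t] acts on the two generators and on the centre of the Heisenberg
    group with weights [1], [al] and [1 + al].  The real number [al] is chosen
    so well approximable by rationals that, for every [A], some
    [|p - q al|] is positive and below [exp (- A (p + q + 1))].

    Two elements [g], [h] have a commutator [u] in the Heisenberg group.
    Conjugating [u] by [g ^ m] and by [g ^ n] and taking the commutator gives a
    central element whose coordinate is a constant times
    [E(m, n) - E(n, m)], where [E(m, n) = exp ((m + n al) t)] and [t] is the
    first coordinate of [g].  Hence, for [X = exp t] and [Y = exp (al t)],
    products of such commutators and of their inverses realise, up to that
    constant, [P(X, Y) - P(Y, X)] for all polynomials [P] with integer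
    coefficients, and the choice made in [small_word] yields
    [(X ^ p - Y ^ q) (Y ^ p - X ^ q) (X - Y)] ([small_wordE]).  The first factor
    is at most [|p - q al|] times an exponential in [p + q], the second one is
    at most exponential, and both are nonzero because [al] is irrational.  The
    word has length at most [80 (p + q + 1)] and the ball of that radius has at
    most [5 ^ (80 (p + q + 1))] elements.  As the rate [A] of approximation is
    arbitrary, these words defeat every exponent [beta]
    ([generic_not_beta_diophantine]).  The distance from such a word to [1] is
    at most the modulus of its central coordinate, as a straight segment along
    the centre shows ([dist_central_le]).

    The construction applies to every pair [(g, h)] outside the zero set of a
    continuous function, that is, on a nonempty open set of pairs.  Such a set
    is not negligible for a Haar measure; the only thing missing is that a Haar
    measure exists.  It is obtained as an image of Lebesgue measure: when an
    element is written as (element of the line) times (element of the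
    Heisenberg group), left translations become triangular maps whose
    successive coordinates are translated by amounts depending on the previous
    ones only, and these preserve Lebesgue measure by Fubini's theorem
    ([preserves_skew], [haar_pair_haar]). *)

(** * Smoothness of exponential polynomials *)

Section Smooth.
Context {R : realType}.

(** A class of functions that contains the coordinates of the group law and of
    the metric and is stable under directional derivatives: smoothness then
    follows by induction on the order of differentiability. *)
Inductive exppoly (V : normedModType R) : (V -> R) -> Prop :=
| exppoly_cst (a : R) : exppoly (fun=> a)
| exppoly_lin (l : {linear V -> R}) : continuous l -> exppoly l
| exppolyD f g : exppoly f -> exppoly g -> exppoly (fun x => f x + g x)
| exppolyM f g : exppoly f -> exppoly g -> exppoly (fun x => f x * g x)
| exppoly_exp f : exppoly f -> exppoly (fun x => expR (f x)).

Lemma exppoly_diff (V : normedModType R) (f : V -> R) : exppoly f ->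
  (forall x, differentiable f x) /\ forall v, exppoly (fun x => 'd f x v).
Proof.
elim=> {f} [a|l cl|f g ef [df Df] eg [dg Dg]|f g ef [df Df] eg [dg Dg]|f ef [df Df]].
- split=> [x|v]; first exact: differentiable_cst.
  have -> : (fun x : V => 'd (fun=> a) x v) = fun=> 0.
    by apply/funext => x; rewrite diff_cst.
  exact: exppoly_cst.
- split=> [x|v]; first exact: linear_differentiable.
  have -> : (fun x : V => 'd l x v) = fun=> l v.
    by apply/funext => x; rewrite diff_lin.
  exact: exppoly_cst.
- split=> [x|v]; first exact: differentiableD.
  have -> : (fun x : V => 'd (fun x => f x + g x) x v) =
            fun x => 'd f x v + 'd g x v.
    by apply/funext => x; rewrite diffD.
  exact: exppolyD.
- split=> [x|v]; first exact: differentiableM.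
  have -> : (fun x : V => 'd (fun x => f x * g x) x v) =
            fun x => f x * 'd g x v + g x * 'd f x v.
    by apply/funext => x; rewrite diffM.
  by apply: exppolyD; apply: exppolyM.
- have de (y : R) : differentiable (expR : R -> R) y.
    exact/derivable1_diffP/derivable_expR.
  split=> [x|v]; first exact: differentiable_comp.
  have -> : (fun x : V => 'd (fun x => expR (f x)) x v) =
            fun x => 'd f x v * expR (f x).
    apply/funext => x; rewrite (diff_comp (df x) (de (f x))) /=.
    by rewrite diff1E //= derive1E derive_val.
  by apply: exppolyM => //; exact: exppoly_exp.
Qed.

Inductive vexppoly (V W : normedModType R) : (V -> W) -> Prop :=
| vexppoly0 : vexppoly (fun=> 0)
| vexppolyZ f w : exppoly f -> vexppoly (fun x => f x *: w)
| vexppolyD f g : vexppoly f -> vexppoly g -> vexppoly (fun x => f x + g x).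

Lemma vexppoly_diff (V W : normedModType R) (f : V -> W) : vexppoly f ->
  (forall x, differentiable f x) /\ forall v, vexppoly (fun x => 'd f x v).
Proof.
elim=> {f} [|f w /exppoly_diff [df Df]|f g ef [df Df] eg [dg Dg]].
- split=> [x|v]; first exact: differentiable_cst.
  have -> : (fun x : V => 'd (fun=> 0 : W) x v) = fun=> 0.
    by apply/funext => x; rewrite diff_cst.
  exact: vexppoly0.
- split=> [x|v]; first exact: differentiableZl.
  have -> : (fun x : V => 'd (fun x => f x *: w) x v) = fun x => 'd f x v *: w.
    by apply/funext => x; rewrite diffZl.
  exact: vexppolyZ.
- split=> [x|v]; first exact: differentiableD.
  have -> : (fun x : V => 'd (fun x => f x + g x) x v) =
            fun x => 'd f x v + 'd g x v.
    by apply/funext => x; rewrite diffD.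
  exact: vexppolyD.
Qed.

Lemma vexppoly_smooth (V W : normedModType R) (U : set V) (f : V -> W) :
  vexppoly f -> smooth U f.
Proof.
move=> ef n; elim: n f ef => [|n IH] f /[dup] ef /vexppoly_diff [df Df] /=.
  by move=> x _; exact: differentiable_continuous.
by split=> // v; exact: IH.
Qed.

Lemma vexppoly_sum (V W : normedModType R) (I : Type) (r : seq I)
  (F : I -> V -> W) : (forall i, vexppoly (F i)) ->
  vexppoly (fun x => \sum_(i <- r) F i x).
Proof.
move=> eF; elim: r => [|i r IH].
  by rewrite (_ : (fun _ => _) = fun=> 0);
    [exact: vexppoly0|apply/funext => x; rewrite big_nil].
rewrite (_ : (fun _ => _) = fun x => F i x + \sum_(j <- r) F j x).
  exact: vexppolyD.
by apply/funext => x; rewrite big_cons.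
Qed.

Lemma matrix_smooth (V : normedModType R) m n (U : set V) (f : V -> 'M[R]_(m, n)) :
  (forall i j, exppoly (fun x => f x i j)) -> smooth U f.
Proof.
move=> ef; apply: vexppoly_smooth.
rewrite (_ : f = fun x => \sum_i \sum_j f x i j *: delta_mx i j).
  by do 2!(apply: vexppoly_sum => ?); exact: vexppolyZ.
by apply/funext => x; exact: matrix_sum_delta.
Qed.
End Smooth.

(** * Coordinates on the four-dimensional space *)

Lemma expR_neq0 {R : realType} (x : R) : expR x != 0.
Proof. by rewrite gt_eqF ?expR_gt0. Qed.

Section Coordinates.
Context {R : realType}.
Definition ct (p : 'rV[R]_4) : R := p 0 (@Ordinal 4 0 isT).
Definition cx (p : 'rV[R]_4) : R := p 0 (@Ordinal 4 1 isT).
Definition cy (p : 'rV[R]_4) : R := p 0 (@Ordinal 4 2 isT).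
Definition cz (p : 'rV[R]_4) : R := p 0 (@Ordinal 4 3 isT).
Definition vec4 (t x y z : R) : 'rV[R]_4 := \row_j [:: t; x; y; z]`_j.

Lemma ct_vec4 t x y z : ct (vec4 t x y z) = t. Proof. by rewrite /ct mxE. Qed.
Lemma cx_vec4 t x y z : cx (vec4 t x y z) = x. Proof. by rewrite /cx mxE. Qed.
Lemma cy_vec4 t x y z : cy (vec4 t x y z) = y. Proof. by rewrite /cy mxE. Qed.
Lemma cz_vec4 t x y z : cz (vec4 t x y z) = z. Proof. by rewrite /cz mxE. Qed.
Definition vec4E := (ct_vec4, cx_vec4, cy_vec4, cz_vec4).

Lemma row4P (p q : 'rV[R]_4) :
  ct p = ct q -> cx p = cx q -> cy p = cy q -> cz p = cz q -> p = q.
Proof.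
move=> h0 h1 h2 h3; apply/rowP => -[[|[|[|[|//]]]] i];
  rewrite (bool_irrelevance i isT); [exact: h0|exact: h1|exact: h2|exact: h3].
Qed.

Lemma vec4_eta p : vec4 (ct p) (cx p) (cy p) (cz p) = p.
Proof. by apply: row4P; rewrite vec4E. Qed.

Lemma exppoly_vec4 (V : normedModType R) (t x y z : V -> R) :
  exppoly t -> exppoly x -> exppoly y -> exppoly z ->
  forall i j, exppoly (fun v => vec4 (t v) (x v) (y v) (z v) i j).
Proof.
move=> et ex ey ez i [[|[|[|[|//]]]] j];
by under eq_fun do rewrite mxE /=.
Qed.

(** Coordinates of one or two elements as named functions, so that they can
    carry a structure of linear map. *)
Definition row4_fst (i : 'I_4) (p : 'rV[R]_4 * 'rV[R]_4) : R := p.1 0 i.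
Definition row4_snd (i : 'I_4) (p : 'rV[R]_4 * 'rV[R]_4) : R := p.2 0 i.
Definition row4_coord (i : 'I_4) (p : 'rV[R]_4) : R := p 0 i.
Fact row4_fst_linear i : linear (row4_fst i).
Proof. by move=> a u v; rewrite /row4_fst /= !mxE. Qed.
Fact row4_snd_linear i : linear (row4_snd i).
Proof. by move=> a u v; rewrite /row4_snd /= !mxE. Qed.
Fact row4_coord_linear i : linear (row4_coord i).
Proof. by move=> a u v; rewrite /row4_coord /= !mxE. Qed.
HB.instance Definition _ i :=
  GRing.isLinear.Build R _ _ _ (row4_fst i) (row4_fst_linear i).
HB.instance Definition _ i :=
  GRing.isLinear.Build R _ _ _ (row4_snd i) (row4_snd_linear i).
HB.instance Definition _ i :=
  GRing.isLinear.Build R _ _ _ (row4_coord i) (row4_coord_linear i).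

Lemma exppoly_row4_fst i : exppoly (row4_fst i).
Proof.
apply: exppoly_lin => p.
apply: (@continuous_comp _ _ _ fst (row4_coord i)); first exact: cvg_fst.
exact: coord_continuous.
Qed.
Lemma exppoly_row4_snd i : exppoly (row4_snd i).
Proof.
apply: exppoly_lin => p.
apply: (@continuous_comp _ _ _ snd (row4_coord i)); first exact: cvg_snd.
exact: coord_continuous.
Qed.
Lemma exppoly_row4_coord i : exppoly (row4_coord i).
Proof. by apply: exppoly_lin => p; exact: coord_continuous. Qed.

Lemma ct_continuous : continuous ct. Proof. exact: coord_continuous. Qed.
Lemma cx_continuous : continuous cx. Proof. exact: coord_continuous. Qed.
Lemma cy_continuous : continuous cy. Proof. exact: coord_continuous. Qed.
Lemma cz_continuous : continuous cz. Proof. exact: coord_continuous. Qed.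

Lemma vec4_continuous (T : topologicalType) (t x y z : T -> R) :
  continuous t -> continuous x -> continuous y -> continuous z ->
  continuous (fun v => vec4 (t v) (x v) (y v) (z v)).
Proof.
move=> ct_ cx_ cy_ cz_.
pose e j : 'rV[R]_4 := delta_mx 0 j.
have -> : (fun v => vec4 (t v) (x v) (y v) (z v)) =
    fun v => t v *: e (@Ordinal 4 0 isT) + x v *: e (@Ordinal 4 1 isT)
           + y v *: e (@Ordinal 4 2 isT) + z v *: e (@Ordinal 4 3 isT).
  apply/funext => v; apply: row4P; rewrite vec4E /ct /cx /cy /cz !mxE /=;
    by rewrite !mulr0 ?mulr1 ?add0r ?addr0.
move=> v; apply: cvgD; last by apply: cvgZr_tmp; exact: cz_.
apply: cvgD; last by apply: cvgZr_tmp; exact: cy_.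
by apply: cvgD; apply: cvgZr_tmp; [exact: ct_|exact: cx_].
Qed.

Lemma exppolyN (V : normedModType R) (f : V -> R) :
  exppoly f -> exppoly (fun x => - f x).
Proof.
move=> ef; under eq_fun do rewrite -mulN1r.
by apply: exppolyM => //; exact: exppoly_cst.
Qed.

End Coordinates.

Ltac solve_exppoly := repeat first
  [ exact: exppoly_row4_fst | exact: exppoly_row4_snd
  | exact: exppoly_row4_coord | exact: exppoly_cst
  | apply: exppolyD | apply: exppolyM | apply: exppolyN | apply: exppoly_exp ].

(** * Second countability *)

Lemma countable_image (T U : Type) (f : T -> U) (A : set T) :
  countable A -> countable (f @` A).
Proof. exact/sub_countable/card_image_le. Qed.

Lemma openX (T U : topologicalType) (A : set T) (B : set U) :
  open A -> open B -> open (A `*` B).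
Proof.
rewrite !openE => oA oB [x y] [/= /oA Ax /oB By].
by exists (A, B).
Qed.

Lemma second_countable_retract (T U : topologicalType) (f : T -> U) (g : U -> T) :
  continuous f -> continuous g -> cancel g f ->
  @second_countable T -> @second_countable U.
Proof.
move=> cf cg gK [B cB [oB bB]].
exists [set g @^-1` b | b in B]; first exact: countable_image.
split=> [_ [b Bb <-]|x V /= Vx]; 
  first by apply: open_comp; [move=> y _; exact: cg|exact: oB].
have := cf (g x) V; rewrite /= gK => /(_ Vx) /(bB (g x)) [b [Bb bx] bV].
exists (g @^-1` b); first by split=> //; exists b.
by move=> y /= /bV; rewrite /= gK.
Qed.

Lemma second_countable_prod (T U : topologicalType) :
  @second_countable T -> @second_countable U -> @second_countable (T * U)%type.
Proof.
move=> [B cB [oB bB]] [C cC [oC bC]].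
exists [set bc.1 `*` bc.2 | bc in B `*` C].
  by apply: countable_image; exact: countableX.
split=> [_ [[b c] [/= Bb Cc] <-]|[x y] V /= [[P Q] [/= Px Qy] PQV]].
  by apply: openX; [exact: oB|exact: oC].
have [b [Bb bx] bP] := bB _ _ Px; have [c [Cc cy] cQ] := bC _ _ Qy.
exists (b `*` c); first by split=> //; exists (b, c).
by move=> [u v] [/= bu cv]; apply: PQV; split; [exact: bP|exact: cQ].
Qed.

Lemma second_countable_real (R : realType) : @second_countable R.
Proof.
pose I (q : rat * rat) : set R := `]ratr q.1, ratr q.2[%classic.
exists (range I); first exact: countable_image.
split=> [_ [q _ <-]|x V /=]; first exact: interval_open.
rewrite -nbhs_ballE => -[e /= e0 xeV].
have /rat_in_itvoo [q] : x - e < x by rewrite ltrBlDr ltrDl.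
rewrite in_itv /= => /andP[q1 q2].
have /rat_in_itvoo [r] : x < x + e by rewrite ltrDl.
rewrite in_itv /= => /andP[r1 r2].
exists (I (q, r)); first by split; [exists (q, r)|rewrite /I /= in_itv /= q2 r1].
move=> y; rewrite /I /= in_itv /= => /andP[qy yr]; apply: xeV.
by rewrite /ball /= ltr_distlC (lt_trans q1)//= (lt_trans yr).
Qed.

(** * The Lie group *)

(** The semidirect product of the Heisenberg group by the line, carried by the
    space of its coordinates [(t, x, y, z)]. *)
Definition heis (R : realType) (al : R) : Type := 'rV[R]_4.
HB.instance Definition _ (R : realType) (al : R) :=
  PointedTopological.copy (heis al) 'rV[R]_4.

Section HeisGroup.
Context {R : realType} (al : R).
Local Notation G := (heis al).
Implicit Types p q : G.

Definition heis_mul p q : G :=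
  vec4 (ct p + ct q)
       (cx p + expR (ct p) * cx q)
       (cy p + expR (al * ct p) * cy q)
       (cz p + expR (ct p) * expR (al * ct p) * cz q
             + cx p * expR (al * ct p) * cy q).
Definition heis_one : G := vec4 0 0 0 0.
Definition heis_inv p : G :=
  vec4 (- ct p)
       (- (expR (- ct p) * cx p))
       (- (expR (- (al * ct p)) * cy p))
       (expR (- ct p) * expR (- (al * ct p)) * (cx p * cy p + - cz p)).

Lemma heis_mulA : associative heis_mul.
Proof.
by move=> p q r; apply: row4P; rewrite /heis_mul !vec4E ?mulrDr ?expRD; ring.
Qed.
Lemma heis_mul1 : left_id heis_one heis_mul.
Proof.
by move=> p; apply: row4P; rewrite /heis_mul !vec4E ?mulr0 ?expR0; ring.
Qed.
Lemma heis_mulr1 : right_id heis_one heis_mul.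
Proof. by move=> p; apply: row4P; rewrite /heis_mul !vec4E; ring. Qed.
Lemma heis_mulV : left_inverse heis_one heis_inv heis_mul.
Proof.
by move=> p; apply: row4P; rewrite /heis_mul !vec4E ?mulrN ?expRN; field;
  rewrite ?expR_neq0.
Qed.
Lemma heis_mulrV : right_inverse heis_one heis_inv heis_mul.
Proof.
by move=> p; apply: row4P; rewrite /heis_mul !vec4E ?mulrN ?expRN; field;
  rewrite ?expR_neq0.
Qed.

HB.instance Definition _ := isGroup.Build G
  heis_mulA heis_mul1 heis_mulr1 heis_mulV heis_mulrV.

Lemma heis_mul_exppoly i j :
  exppoly (fun z : 'rV[R]_4 * 'rV[R]_4 => heis_mul z.1 z.2 i j).
Proof. by apply: exppoly_vec4; solve_exppoly. Qed.

Lemma heis_inv_exppoly i j :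
  exppoly (fun z : 'rV[R]_4 => heis_inv z i j).
Proof. by apply: exppoly_vec4; solve_exppoly. Qed.

Lemma heis_mul_continuous : continuous (fun z : G * G => (z.1 * z.2)%g).
Proof.
move=> z.
exact: (@matrix_smooth R _ _ _ setT _ heis_mul_exppoly 0%N z I).
Qed.

Lemma heis_inv_continuous : continuous (fun x : G => (x^-1)%g).
Proof.
move=> z.
exact: (@matrix_smooth R _ _ _ setT _ heis_inv_exppoly 0%N z I).
Qed.

HB.instance Definition _ :=
  isTopologicalGroup.Build G heis_mul_continuous heis_inv_continuous.

Fact heis_chart_im_open : open ((fun p : G => p : 'rV[R]_4) @` [set: G]).
Proof. by rewrite image_id; exact: openT. Qed.

Definition heis_chart : chart R G 4 :=
  @Chart R G 4 setT (fun p => p) (fun p => p) openT heis_chart_im_open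
    (fun _ _ => erefl) (fun _ _ => cvg_id) (fun _ _ => cvg_id).

Lemma heis_hausdorff : hausdorff_space G.
Proof. exact: (@norm_hausdorff R 'rV[R]_4). Qed.

Lemma heis_second_countable : @second_countable G.
Proof.
pose f (p : (R * R) * (R * R)) : 'rV[R]_4 := vec4 p.1.1 p.1.2 p.2.1 p.2.2.
pose g (p : 'rV[R]_4) : (R * R) * (R * R) := ((ct p, cx p), (cy p, cz p)).
apply: (@second_countable_retract _ _ f g).
- apply: vec4_continuous => p.
  + by apply: (@continuous_comp _ _ _ fst fst); exact: cvg_fst.
  + by apply: (@continuous_comp _ _ _ fst snd); [exact: cvg_fst|exact: cvg_snd].
  + by apply: (@continuous_comp _ _ _ snd fst); [exact: cvg_snd|exact: cvg_fst].
  + by apply: (@continuous_comp _ _ _ snd snd); exact: cvg_snd.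
- move=> p; exact: (cvg_pair (cvg_pair (@ct_continuous R p) (@cx_continuous R p))
                            (cvg_pair (@cy_continuous R p) (@cz_continuous R p))).
- by move=> p; exact: vec4_eta.
by do 2!apply: second_countable_prod; exact: second_countable_real.
Qed.

Lemma id_smooth (U : set 'rV[R]_4) : smooth U (fun p : 'rV[R]_4 => p).
Proof. by apply: matrix_smooth => i j; rewrite ord1; exact: exppoly_row4_coord. Qed.

Fact heis_atlas_cover (x : G) :
  exists2 c, [set heis_chart] c & chart_dom c x.
Proof. by exists heis_chart. Qed.
Fact heis_atlas_compatible c c' : [set heis_chart] c -> [set heis_chart] c' ->
    smooth (c @` (chart_dom c `&` chart_dom c')) (c' \o chart_inv c).
Proof. move=> -> ->; exact: id_smooth. Qed.
Fact heis_mul_smooth c1 c2 c3 :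
    [set heis_chart] c1 -> [set heis_chart] c2 -> [set heis_chart] c3 ->
    smooth [set p : 'rV[R]_4 * 'rV[R]_4 |
             [/\ chart_im c1 p.1, chart_im c2 p.2 &
                 chart_dom c3 (chart_inv c1 p.1 * chart_inv c2 p.2)%g]]
           (fun p : 'rV[R]_4 * 'rV[R]_4 => c3 (chart_inv c1 p.1 * chart_inv c2 p.2)%g).
Proof. by move=> -> -> ->; apply: matrix_smooth; exact: heis_mul_exppoly. Qed.
Fact heis_inv_smooth c1 c2 : [set heis_chart] c1 -> [set heis_chart] c2 ->
    smooth [set p : 'rV[R]_4 |
             chart_im c1 p /\ chart_dom c2 ((chart_inv c1 p)^-1)%g]
           (fun p : 'rV[R]_4 => c2 ((chart_inv c1 p)^-1)%g).
Proof. by move=> -> ->; apply: matrix_smooth; exact: heis_inv_exppoly. Qed.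

HB.instance Definition _ := isLieGroup.Build R G
  heis_hausdorff heis_second_countable heis_atlas_cover heis_atlas_compatible
  heis_mul_smooth heis_inv_smooth.

Lemma heis_connected : connected [set: G].
Proof.
have -> : [set: G] = \bigcup_(p : G) ((fun s : R => s *: (p : 'rV[R]_4)) @` `[0, 1]).
  apply/seteqP; split=> // p _; exists p => //; exists 1; rewrite ?scale1r //.
  by rewrite /= in_itv /= ler01 lexx.
apply: bigcup_connected.
  exists (0 : 'rV[R]_4) => p _; exists 0; rewrite ?scale0r //.
  by rewrite /= in_itv /= ler01 lexx.
move=> p _; apply: connected_continuous_connected; first exact: segment_connected.
apply: continuous_subspaceT => s.
exact: (@scalel_continuous _ 'rV[R]_4).
Qed.
End HeisGroup.

(** * A left-invariant metric *)

Section Metric.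
Context {R : realType} (al : R).
Local Notation G := (heis al).
Implicit Types (p q h : G) (u v : 'rV[R]_4).

(** The coordinates, at the point [p], of the tangent vector [u] in the frame of
    left-invariant vector fields: the left-invariant metric is the one for which
    this frame is orthonormal. *)
Definition coframe p u : 'rV[R]_4 :=
  vec4 (ct u)
       (expR (- ct p) * cx u)
       (expR (- (al * ct p)) * cy u)
       (expR (- ct p) * expR (- (al * ct p)) * (cz u + - (cx p * cy u))).

(** Left translations are affine maps in these coordinates, with the following
    linear part. *)
Definition translation_diff h u : 'rV[R]_4 :=
  vec4 (ct u)
       (expR (ct h) * cx u)
       (expR (al * ct h) * cy u)
       (expR (ct h) * expR (al * ct h) * cz u + cx h * expR (al * ct h) * cy u).

Lemma ctD u v : ct (u + v) = ct u + ct v. Proof. by rewrite /ct mxE. Qed.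
Lemma cxD u v : cx (u + v) = cx u + cx v. Proof. by rewrite /cx mxE. Qed.
Lemma cyD u v : cy (u + v) = cy u + cy v. Proof. by rewrite /cy mxE. Qed.
Lemma czD u v : cz (u + v) = cz u + cz v. Proof. by rewrite /cz mxE. Qed.
Lemma ctZ a u : ct (a *: u) = a * ct u. Proof. by rewrite /ct mxE. Qed.
Lemma cxZ a u : cx (a *: u) = a * cx u. Proof. by rewrite /cx mxE. Qed.
Lemma cyZ a u : cy (a *: u) = a * cy u. Proof. by rewrite /cy mxE. Qed.
Lemma czZ a u : cz (a *: u) = a * cz u. Proof. by rewrite /cz mxE. Qed.
Lemma ctN u : ct (- u) = - ct u. Proof. by rewrite /ct mxE. Qed.
Lemma cxN u : cx (- u) = - cx u. Proof. by rewrite /cx mxE. Qed.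
Lemma cyN u : cy (- u) = - cy u. Proof. by rewrite /cy mxE. Qed.
Lemma czN u : cz (- u) = - cz u. Proof. by rewrite /cz mxE. Qed.
Definition coordE := (ctD, cxD, cyD, czD, (ctZ, cxZ, cyZ, czZ), (ctN, cxN, cyN, czN)).

Fact coframe_linear p : linear (coframe p).
Proof.
by move=> a u v; apply: row4P; rewrite /coframe !(coordE, vec4E); ring.
Qed.
HB.instance Definition _ p :=
  GRing.isLinear.Build R _ _ _ (coframe p) (coframe_linear p).

Fact translation_diff_linear h : linear (translation_diff h).
Proof.
by move=> a u v; apply: row4P; rewrite /translation_diff !(coordE, vec4E); ring.
Qed.
HB.instance Definition _ h :=
  GRing.isLinear.Build R _ _ _ (translation_diff h) (translation_diff_linear h).

Lemma coframe_translation h p u :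
  coframe (heis_mul h p) (translation_diff h u) = coframe p u.
Proof.
by apply: row4P; rewrite /coframe /translation_diff /heis_mul !vec4E
  ?mulrDr ?opprD ?expRD ?expRN; field; rewrite ?expR_neq0.
Qed.

Lemma coframe_eq0 p u : coframe p u = 0 -> u = 0.
Proof.
move=> e0; have z0 (f : 'rV[R]_4 -> R) : f (coframe p u) = f 0 by rewrite e0.
have t0 := z0 ct; have x0 := z0 cx; have y0 := z0 cy; have := z0 cz.
move: t0 x0 y0; rewrite /coframe !vec4E.
rewrite /ct /cx /cy /cz !mxE -/(ct u) -/(cx u) -/(cy u) -/(cz u) -/(cx p).
move=> t0 /eqP; rewrite mulf_eq0 (negbTE (expR_neq0 _)) => /eqP x0.
move=> /eqP; rewrite mulf_eq0 (negbTE (expR_neq0 _)) => /eqP y0.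
rewrite y0 mulr0 subr0.
move=> /eqP; rewrite !mulf_eq0 !(negbTE (expR_neq0 _)) => /eqP z1.
by apply: row4P; rewrite ?t0 ?x0 ?y0 ?z1 /ct /cx /cy /cz mxE.
Qed.

Definition heis_gram (c : chart R G 4) (p : 'rV[R]_4) : 'M[R]_4 :=
  lin1_mx (coframe p) *m (lin1_mx (coframe p))^T.

Lemma bilin_gram c p u v :
  (u *m heis_gram c p *m v^T) 0 0 = \sum_j coframe p u 0 j * coframe p v 0 j.
Proof.
rewrite /heis_gram mulmxA -mulmxA -trmx_mul !mul_rV_lin1 mxE.
by apply: eq_bigr => j _; rewrite [in X in _ * X = _]mxE.
Qed.

Lemma coframe_exppoly u j : exppoly (fun p : 'rV[R]_4 => coframe p u 0 j).
Proof. by apply: exppoly_vec4; solve_exppoly. Qed.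

Lemma lin1_coframeE p i j :
  lin1_mx (coframe p) i j = coframe p (delta_mx 0 i) 0 j.
Proof. by rewrite mxE. Qed.

Fact heis_gram_smooth c : lie_atlas G c -> smooth (chart_im c) (heis_gram c).
Proof.
move=> _; apply: matrix_smooth => i j.
under eq_fun do rewrite mxE.
elim: (index_enum _) => [|k r IH].
  by under eq_fun do rewrite big_nil; exact: exppoly_cst.
under eq_fun do rewrite big_cons.
apply: exppolyD => //; under eq_fun do rewrite [X in _ * X]mxE !lin1_coframeE.
by apply: exppolyM; exact: coframe_exppoly.
Qed.

Fact heis_gram_sym c p : lie_atlas G c -> chart_im c p ->
  (heis_gram c p)^T = heis_gram c p.
Proof. by move=> _ _; rewrite /heis_gram trmx_mul trmxK. Qed.

Fact heis_gram_gt0 c p (u : 'rV[R]_4) : lie_atlas G c -> chart_im c p -> u != 0 ->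
  0 < @bilin R G (heis_gram c p) u u.
Proof.
move=> _ _; rewrite /bilin bilin_gram ltNge; apply: contraNN => le0.
apply/eqP/(@coframe_eq0 p)/rowP => j; rewrite [RHS]mxE.
have sq_ge0 k : 0 <= coframe p u 0 k * coframe p u 0 k by rewrite -expr2 sqr_ge0.
have /eqP : \sum_j coframe p u 0 j * coframe p u 0 j = 0.
  by apply/eqP; rewrite eq_le le0 sumr_ge0.
rewrite psumr_eq0// => /allP /(_ j); rewrite mem_index_enum => /(_ isT)/=.
by rewrite mulf_eq0 orbb => /eqP.
Qed.

Lemma diff_affine (V W : normedModType R) (f : {linear V -> W}) (c : W) (x v : V) :
  continuous f -> 'd (fun y => f y + c) x v = f v.
Proof.
move=> cf; have -> : (fun y => f y + c) = f \+ cst c by [].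
rewrite diffD; [|exact: linear_differentiable|exact: differentiable_cst].
by rewrite diff_cst diff_lin//= addr0.
Qed.

Lemma diff_translation h q u :
  'd (fun p : 'rV[R]_4 => heis_mul h p : 'rV[R]_4) q u = translation_diff h u.
Proof.
have cont : continuous (translation_diff h).
  move=> p; apply: (@matrix_smooth R _ _ _ setT (translation_diff h) _ 0%N p I).
  by apply: exppoly_vec4; solve_exppoly.
have -> : (fun p : 'rV[R]_4 => heis_mul h p : 'rV[R]_4) =
    fun p => translation_diff h p + (h : 'rV[R]_4).
  apply/funext => p; apply: row4P; rewrite /translation_diff /heis_mul /=
    !(coordE, vec4E); ring.
exact: (diff_affine _ _ _ cont).
Qed.

Lemma heis_translation_isometric h c c' x : lie_atlas G c -> lie_atlas G c' ->
  translation_isometric_at heis_gram h c c' x.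
Proof.
move=> -> -> u v; rewrite /bilin !bilin_gram.
rewrite /chart_translation /= !diff_translation.
by apply: eq_bigr => j _; rewrite !coframe_translation.
Qed.

Definition heis_metric : riemannian_metric G :=
  @RiemannianMetric R G heis_gram heis_gram_smooth heis_gram_sym heis_gram_gt0
    (fun c c' x Ac Ac' _ _ => @heis_translation_isometric 1%g c c' x Ac Ac').

Lemma heis_metric_left_invariant : left_invariant heis_metric.
Proof. by move=> h c c' x Ac Ac' _ _; exact: heis_translation_isometric. Qed.
End Metric.

Section Dist.
Context {R : realType} (al : R).
Local Notation G := (heis al).

Definition central (e : R) : G := vec4 0 0 0 e.

Section Segment.
Variable w : 'rV[R]_4.
Definition segment_to_0 (s : R) : 'rV[R]_4 := (1 - s) *: w.

Lemma segment_to_0_vexppoly : vexppoly (segment_to_0 : R^o -> 'rV[R]_4).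
Proof.
apply: vexppolyZ; apply: exppolyD; first exact: exppoly_cst.
by apply: exppolyN; apply: (@exppoly_lin _ _ idfun) => x; exact: cvg_id.
Qed.

Lemma derive1_segment_to_0 (t : R) : derive1 segment_to_0 t = - w.
Proof.
have dk : differentiable (fun s : R => 1 - s) t.
  by apply/derivable1_diffP; exact: ex_derive.
have df : differentiable segment_to_0 t by exact: differentiableZl.
rewrite derive1E'// diffZl// diff1E//= derive1E derive_val.
by rewrite add0r scale1r mul1r scaleN1r.
Qed.
End Segment.

(** On the segment from [central e] to [1] the first two coordinates vanish, so
    the frame has constant coefficients there and the speed is constant. *)
Lemma dist_central_le (e : R) :
  (riemannian_dist (heis_metric al) (central e) 1%g <= `|e|%:E)%E.
Proof.
apply: ereal_inf_lbound; exists (segment_to_0 (central e)), (fun=> `|e|); split.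
- split=> [s|c ->].
    exact: (@vexppoly_smooth R R^o _ setT _ (segment_to_0_vexppoly (central e)) 0%N s I).
  exact: (vexppoly_smooth _ (segment_to_0_vexppoly (central e)) 1%N).
- by rewrite /segment_to_0 subr0 scale1r.
- rewrite /segment_to_0 subrr scale0r.
  by apply: row4P; rewrite /= /heis_one !vec4E /ct /cx /cy /cz mxE.
- move=> t c -> _; rewrite /bilin bilin_gram.
  have -> : derive1 (@heis_chart R al \o segment_to_0 (central e)) t =
            - (central e : 'rV[R]_4).
    exact: derive1_segment_to_0.
  have -> : @coframe R al (@heis_chart R al (segment_to_0 (central e) t))
     (- (central e : 'rV[R]_4)) = vec4 0 0 0 (- e).
    rewrite /= /segment_to_0; apply: row4P;
      rewrite /coframe /central !(coordE, vec4E) ?mulr0 ?oppr0 ?expR0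
        ?mul1r ?mul0r ?oppr0 ?addr0 ?mulN1r//.
  by rewrite !big_ord_recl big_ord0 !mxE /= !mulr0 !add0r addr0 mulrNN -expr2 sqrtr_sqr.
- rewrite integral_cst//= lebesgue_measure_itv/= lte_fin ltr01 -EFinB subr0.
  by rewrite mule1.
Qed.
End Dist.

(** * Balls in a finitely generated group *)

Section Words.
Context {G : groupType} (S : set G).
Implicit Types x y : G.
Local Open Scope group_scope.

Lemma letter_ball x : letters S x -> word_ball S 1 x.
Proof. by move=> Sx; exists 1 => //; exists x; rewrite ?mul1g. Qed.

Lemma word_ballM m n x y :
  word_ball S m x -> word_ball S n y -> word_ball S (m + n) (x * y).
Proof.
move=> Bx; elim: n y => [y ->|n IH _ [y By [z Sz <-]]].
  by rewrite addn0 mulg1.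
by rewrite addnS mulgA; exists (x * y); [exact: IH|exists z].
Qed.

Lemma letters_inv x : letters S x -> letters S x^-1.
Proof.
move=> [[Sx|[y Sy <-]]|->].
- by left; right; exists x.
- by left; left; rewrite invgK.
- by right; rewrite invg1.
Qed.

Lemma word_ballV n x : word_ball S n x -> word_ball S n x^-1.
Proof.
elim: n x => [x ->|n IH _ [x Bx [y Sy <-]]]; first by rewrite invg1.
rewrite invgM -add1n; apply: word_ballM; last exact: IH.
exact/letter_ball/letters_inv.
Qed.

Lemma word_ball_leq m n x : (m <= n)%N -> word_ball S m x -> word_ball S n x.
Proof.
move=> /subnKC <- Bx; elim: (n - m)%N => [|k IH]; first by rewrite addn0.
by rewrite addnS; exists x => //; exists 1; [right|rewrite mulg1].
Qed.

Lemma word_ballX m n x : word_ball S m x -> word_ball S (n * m) (x ^+ n).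
Proof.
by move=> Bx; elim: n => [//|n IH]; rewrite expgS mulSn; exact: word_ballM.
Qed.
End Words.

Section BallCard.
Context {G : groupType} (k : nat) (x : 'I_k -> G).
Local Open Scope group_scope.

Let letter_seq : seq G :=
  [seq x i | i <- enum 'I_k] ++ [seq (x i)^-1 | i <- enum 'I_k] ++ [:: 1].

Let ball_seq (n : nat) : seq G :=
  iter n (fun s => [seq a * b | a <- s, b <- letter_seq]) [:: 1].

Let size_ball_seq n : size (ball_seq n) = (k.*2.+1 ^ n)%N.
Proof.
elim: n => [//|n IH].
rewrite /ball_seq iterS -/(ball_seq n) size_allpairs IH.
rewrite !size_cat (size_map x) (size_map (fun i => (x i)^-1)) size_enum_ord /=.
by rewrite addnA addnn addn1 expnSr.
Qed.

Let letters_sub a : letters (range x) a -> a \in letter_seq.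
Proof.
have mem i : i \in enum 'I_k by rewrite mem_enum.
rewrite !mem_cat; move=> [[[i _ <-]|[_ [i _ <-] <-]]|->].
- by rewrite map_f.
- by rewrite (map_f (fun i => (x i)^-1))// orbT.
- by rewrite mem_seq1 eqxx !orbT.
Qed.

Let word_ball_sub n a : word_ball (range x) n a -> a \in ball_seq n.
Proof.
elim: n a => [a ->|n IH _ [a Ba [b Sb <-]]]; first by rewrite mem_seq1.
by apply: allpairs_f; [exact: IH|exact: letters_sub].
Qed.

Lemma card_word_ball n :
  (0 < #|` fset_set (word_ball (range x) n)| <= k.*2.+1 ^ n)%N.
Proof.
pose B := [fset a in ball_seq n]%fset.
have sub : word_ball (range x) n `<=` [set` B].
  by move=> a /word_ball_sub aB; rewrite /= !inE.
have fin : finite_set (word_ball (range x) n).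
  exact: sub_finite_set sub (finite_fset B).
apply/andP; split.
  rewrite cardfs_gt0; apply/fset0Pn; exists 1.
  rewrite in_fset_set//; apply/mem_set.
  by apply: (word_ball_leq (leq0n n)).
rewrite -size_ball_seq (leq_trans _ (size_undup (ball_seq n)))//.
rewrite -card_fseq -/B -(set_fsetK B); apply: fsubset_leq_card.
by rewrite -fset_set_sub// set_fsetK.
Qed.
End BallCard.

(** * Commutators, solvability and non-nilpotency *)

Section GeneratedSubgroup.
Context {G : groupType}.

Lemma generated_closed (A : set G) : group_closed (mem (generated A)).
Proof.
split; first by apply/mem_set => H [[]] /set_mem.
move=> u v /set_mem Au /set_mem Av; apply/mem_set => H HA.
by have [[_ HV] _] := HA; apply/set_mem/HV; apply/mem_set; [exact: Au|exact: Av].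
Qed.

Lemma generated_sub (A H : set G) :
  group_closed (mem H) -> A `<=` H -> generated A `<=` H.
Proof. by move=> cH AH; exact: smallest_sub. Qed.

Lemma sub_generated (A : set G) : A `<=` generated A.
Proof. exact: sub_gen_smallest. Qed.

Lemma generated1 (A : set G) : A `<=` [set 1%g] -> generated A = [set 1%g].
Proof.
move=> A1; apply/seteqP; split.
  apply: generated_sub => //; split; first exact/mem_set.
  by move=> u v /set_mem -> /set_mem ->; apply/mem_set; rewrite mulgV.
by move=> _ ->; have [/set_mem] := generated_closed A.
Qed.
End GeneratedSubgroup.

Section HeisAlgebra.
Context {R : realType} (al : R).
Local Notation G := (heis al).
Implicit Types (g h u v : G) (m n p q : nat).

Lemma heis_mulE g h : (g * h)%g = heis_mul g h :> G. Proof. by []. Qed.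
Lemma heis_invE g : (g^-1)%g = heis_inv g :> G. Proof. by []. Qed.
Lemma heis_oneE : 1%g = heis_one al :> G. Proof. by []. Qed.

Lemma ct_mul g h : ct (g * h)%g = ct g + ct h.
Proof. by rewrite heis_mulE vec4E. Qed.
Lemma ct_inv g : ct (g^-1)%g = - ct g.
Proof. by rewrite heis_invE vec4E. Qed.
Lemma cx_mul g h : cx (g * h)%g = cx g + expR (ct g) * cx h.
Proof. by rewrite heis_mulE vec4E. Qed.
Lemma cx_inv g : cx (g^-1)%g = - (expR (- ct g) * cx g).
Proof. by rewrite heis_invE vec4E. Qed.
Lemma cy_mul g h : cy (g * h)%g = cy g + expR (al * ct g) * cy h.
Proof. by rewrite heis_mulE vec4E. Qed.
Lemma cy_inv g : cy (g^-1)%g = - (expR (- (al * ct g)) * cy g).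
Proof. by rewrite heis_invE vec4E. Qed.
Definition heis_coordE := (ct_mul, ct_inv, cx_mul, cx_inv, cy_mul, cy_inv).

Lemma ctX g n : ct (g ^+ n)%g = n%:R * ct g.
Proof.
elim: n => [|n IH]; first by rewrite expg0 heis_oneE vec4E mul0r.
by rewrite expgS ct_mul IH -[n.+1]add1n natrD mulrDl mul1r.
Qed.

(** This is [commg] at the inverses of [g] and [h], a convention for which the
    coordinates [x] and [y] of the commutator carry no factor [exp (- t)]. *)
Definition comm g h : G := (g * h * g^-1 * h^-1)%g.
Definition conj_pow g n u : G := (g ^+ n * u * (g ^+ n)^-1)%g.

Lemma ct_comm g h : ct (comm g h) = 0.
Proof. by rewrite /comm !heis_coordE; ring. Qed.

Lemma cx_comm g h :
  cx (comm g h) = (1 - expR (ct h)) * cx g - (1 - expR (ct g)) * cx h.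
Proof. by rewrite /comm !heis_coordE !expRD !expRN; field; rewrite !expR_neq0. Qed.

Lemma cy_comm g h :
  cy (comm g h) = (1 - expR (al * ct h)) * cy g - (1 - expR (al * ct g)) * cy h.
Proof.
by rewrite /comm !heis_coordE ?mulrDr ?mulrN !expRD !expRN; field; rewrite !expR_neq0.
Qed.

Lemma comm_kernel u v : ct u = 0 -> ct v = 0 ->
  comm u v = central al (cx u * cy v - cy u * cx v).
Proof.
move=> u0 v0; rewrite /comm /central; apply: row4P;
  rewrite !(heis_mulE, heis_invE) /heis_mul /heis_inv !vec4E !u0 !v0
    ?(mulr0, oppr0, addr0) ?expR0; ring.
Qed.

Lemma centralM (a b : R) : (central al a * central al b)%g = central al (a + b).
Proof.
rewrite /central heis_mulE /heis_mul; apply: row4P; rewrite !vec4E ?mulr0 ?expR0;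
  ring.
Qed.

Lemma centralV (a : R) : ((central al a)^-1)%g = central al (- a).
Proof.
rewrite /central heis_invE /heis_inv; apply: row4P;
  rewrite !vec4E ?(mulr0, oppr0, expR0); ring.
Qed.

Section ConjPow.
Variables (g u : G) (n : nat).
Hypothesis u0 : ct u = 0.
Lemma ct_conj_pow : ct (conj_pow g n u) = 0.
Proof. by rewrite /conj_pow !heis_coordE u0; ring. Qed.
Lemma cx_conj_pow : cx (conj_pow g n u) = expR (ct g) ^+ n * cx u.
Proof.
rewrite /conj_pow !heis_coordE u0 addr0 ctX expRN expRM_natl.
by field; rewrite expf_neq0 ?expR_neq0.
Qed.
Lemma cy_conj_pow : cy (conj_pow g n u) = expR (al * ct g) ^+ n * cy u.
Proof.
rewrite /conj_pow !heis_coordE u0 addr0 ctX mulrCA expRN expRM_natl.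
by field; rewrite expf_neq0 ?expR_neq0.
Qed.
End ConjPow.

Lemma comm_conj_pow g u m n : ct u = 0 ->
  comm (conj_pow g m u) (conj_pow g n u) =
  central al (cx u * cy u *
    (expR (ct g) ^+ m * expR (al * ct g) ^+ n
     - expR (ct g) ^+ n * expR (al * ct g) ^+ m)).
Proof.
move=> u0; rewrite comm_kernel ?ct_conj_pow//.
by rewrite !cx_conj_pow// !cy_conj_pow//; congr central; ring.
Qed.

(** The exponents are those of the monomials of
    [X (X ^ p - Y ^ q) (Y ^ p - X ^ q)], and each commutator antisymmetrises its
    monomial in [X] and [Y].  As [(X ^ p - Y ^ q) (Y ^ p - X ^ q)] is symmetric,
    it survives the antisymmetrisation as a factor; the factor [X ^ p - Y ^ q]
    alone would not. *)
Definition small_word g u p q : G :=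
  (comm (conj_pow g p.+1 u) (conj_pow g p u)
   * (comm (conj_pow g (p + q).+1 u) (conj_pow g 0 u))^-1
   * (comm (conj_pow g 1 u) (conj_pow g (p + q) u))^-1
   * comm (conj_pow g q.+1 u) (conj_pow g q u))%g.

Lemma small_wordE g u p q : ct u = 0 ->
  let X := expR (ct g) in let Y := expR (al * ct g) in
  small_word g u p q =
  central al (cx u * cy u * ((X ^+ p - Y ^+ q) * (Y ^+ p - X ^+ q) * (X - Y))).
Proof.
move=> u0 X Y; rewrite /small_word !comm_conj_pow// !centralV !centralM -/X -/Y.
by congr central; rewrite !exprS !exprD !expr0; ring.
Qed.

Lemma comm_ball (S : set G) m n g h : word_ball S m g -> word_ball S n h ->
  word_ball S ((m + n).*2)%N (comm g h).
Proof.
move=> Bg Bh; rewrite -addnn addnA; apply: word_ballM; last exact: word_ballV.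
by apply: word_ballM; [exact: word_ballM|exact: word_ballV].
Qed.

Lemma conj_pow_ball (S : set G) g u m n : word_ball S 1 g -> word_ball S m u ->
  word_ball S (n.*2 + m)%N (conj_pow g n u).
Proof.
move=> /(word_ballX n); rewrite muln1 => Bg Bu; rewrite -addnn addnAC.
by apply: word_ballM; [exact: word_ballM|exact: word_ballV].
Qed.

Lemma small_word_ball (S : set G) g h p q : word_ball S 1 g -> word_ball S 1 h ->
  word_ball S (80 * (p + q).+1) (small_word g (comm g h) p q).
Proof.
move=> Bg Bh.
(* The four commutators have total length [16 (p + q) + 80]. *)
have Bu : word_ball S 4 (comm g h) := comm_ball Bg Bh.
have B m n := comm_ball (conj_pow_ball m Bg Bu) (conj_pow_ball n Bg Bu).
apply: word_ball_leq (word_ballM (word_ballM (word_ballM (B _ _)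
  (word_ballV (B _ _))) (word_ballV (B _ _))) (B _ _)).
lia.
Qed.

(** The derived series goes down to the Heisenberg group, then to its centre,
    then to the trivial group. *)
Lemma heis_solvable : group_solvable G.
Proof.
have cl (P : G -> Prop) : P 1%g -> (forall u v, P u -> P v -> P (u * v^-1)%g) ->
    group_closed (mem [set u | P u]).
  move=> P1 PV; split; first exact/mem_set.
  by move=> u v /set_mem Pu /set_mem Pv; apply/mem_set/PV.
exists 3%N; apply: generated1 => _ [a Ha [b Hb <-]].
have D1 : @derived_series G 1 `<=` [set u | ct u = 0].
  apply: generated_sub => [|_ [u _ [v _ <-]]].
    apply: cl => [|u v u0 v0]; first by rewrite heis_oneE vec4E.
    by rewrite ct_mul ct_inv u0 v0 oppr0 addr0.
  by rewrite /commg /conjg /= !heis_coordE; ring.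
have D2 : @derived_series G 2 `<=` [set u | exists e, u = central al e].
  apply: generated_sub => [|_ [u /D1 u0 [v /D1 v0 <-]]].
    apply: cl => [|_ _ [e ->] [f ->]]; first by exists 0.
    by exists (e - f); rewrite centralV centralM.
  exists (cx (u^-1)%g * cy (v^-1)%g - cy (u^-1)%g * cx (v^-1)%g).
  rewrite -comm_kernel ?ct_inv ?u0 ?v0 ?oppr0//.
  by rewrite /commg /conjg /comm !invgK !mulgA.
have [e ->] := D2 _ Ha; have [f ->] := D2 _ Hb.
rewrite /commg /conjg !centralV !centralM.
by have -> : - e + (- f + (e + f)) = 0 by ring.
Qed.

(** The line acts on the [x] axis by dilations, so that every point of this axis
    is the commutator of another one with an element of the line: the axis stays
    in every term of the lower central series. *)
Lemma heis_not_nilpotent : ~ group_nilpotent G.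
Proof.
have in_series n x : lower_central_series (G:=G) n (vec4 0 x 0 0 : G).
  elim: n x => [//|n IH] x.
  (* The commutator of [(0, x', 0, 0)] and [(-1, 0, 0, 0)] is
     [(0, (e - 1) x', 0, 0)]. *)
  pose u : G := vec4 0 (x / (expR 1 - 1)) 0 0.
  pose v : G := vec4 (- 1) 0 0 0.
  have e1 : expR 1 - 1 != 0 :> R by rewrite subr_eq0 gt_eqF// expR_gt1.
  apply: sub_generated; exists u; first exact: IH.
  exists v => //; rewrite /commg /conjg.
  apply: row4P; rewrite !(heis_mulE, heis_invE) /heis_mul /heis_inv !vec4E
    ?(mulr0, oppr0, opprK, addr0, add0r, expR0, mulrN1, expRN, mul0r) //; field;
    rewrite ?e1 ?expR_neq0 //.
move=> [n nil]; have := in_series n 1; rewrite nil => /(congr1 cx).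
by rewrite heis_oneE !vec4E => /eqP; rewrite oner_eq0.
Qed.
End HeisAlgebra.

(** * A very well approximable number *)

Section Liouville.
Context {R : realType}.

Definition well_approximable (A : nat) (al : R) := exists p q : nat,
  0 < `|p%:R - q%:R * al| < expR (- (A%:R * (p + q).+1%:R)).

Lemma well_approximable_open A : open (well_approximable A).
Proof.
rewrite openE => al [p [q /andP[al0 alA]]].
have cont : continuous (fun x : R => `|p%:R - q%:R * x|).
  move=> x; apply: cvg_norm; apply: cvgB; first exact: cvg_cst.
  by apply: cvgM; [exact: cvg_cst|exact: cvg_id].
have n1 : nbhs al [set x : R | 0 < `|p%:R - q%:R * x|] by exact: cvgr_gt (cont al) _ al0.
have n2 : nbhs al [set x : R | `|p%:R - q%:R * x| < expR (- (A%:R * (p + q).+1%:R))].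
  exact: cvgr_lt (cont al) _ alA.
by apply: filterS2 n1 n2 => x /= h1 h2; exists p, q; rewrite h1 h2.
Qed.

(** As [p] and [q] are nonnegative, density fails among negative numbers; the
    negative half-line is added so that Baire's theorem applies on the whole
    line.  At the positive numbers, density holds because a small shift of a
    rational [p / q] makes [|p - q al|] small and nonzero. *)
Lemma well_approximable_dense A :
  dense (well_approximable A `|` [set x : R | x < 0]).
Proof.
move=> O [x Ox] oO.
have [x0|x0] := ltP x 0; first by exists x; split => //; right.
have := oO; rewrite openE => /(_ x Ox); rewrite /interior -nbhs_ballE => -[e /= e0 eO].
have /rat_in_itvoo [r] : x < x + e by rewrite ltrDl.
rewrite in_itv /= => /andP[xr rx].
have r0 : 0 < r by rewrite -(ltr0q R) (le_lt_trans x0).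
pose p := `|numq r|%N; pose q := `|denq r|%N.
have q0 : (0 < q)%N by rewrite absz_gt0 denq_neq0.
have qR0 : 0 < q%:R :> R by rewrite ltr0n.
have rE : ratr r = p%:R / q%:R :> R.
  by rewrite /ratr !(pmulrn 1) absz_denq gez0_abs// numq_ge0 ltW.
pose M := Num.min (x + e - ratr r) (expR (- (A%:R * (p + q).+1%:R)) / q%:R).
have M0 : 0 < M by rewrite lt_min subr_gt0 rx divr_gt0// expR_gt0.
pose d := M / 2; have d0 : 0 < d by rewrite divr_gt0.
have [d1 d2] : d < x + e - ratr r /\ d < expR (- (A%:R * (p + q).+1%:R)) / q%:R.
  by apply/andP; rewrite -lt_min -/M /d ltr_pdivrMr// ltr_pMr// ltr1n.
exists (ratr r + d); split.
  apply: eO; rewrite /ball /= ltr_distlC; apply/andP; split.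
    by rewrite ltrBlDr; lra.
  by lra.
left; exists p, q.
have -> : p%:R - q%:R * (ratr r + d) = - (q%:R * d).
  by rewrite rE; field; rewrite gt_eqF.
rewrite normrN gtr0_norm ?mulr_gt0//=.
by rewrite mulrC -ltr_pdivlMr.
Qed.

Lemma exists_liouville :
  exists al : R, 0 < al /\ forall A, well_approximable A al.
Proof.
have D A : open (well_approximable A `|` [set x : R | x < 0]) /\
    dense (well_approximable A `|` [set x : R | x < 0]).
  split; last exact: well_approximable_dense.
  by apply: openU; [exact: well_approximable_open|exact: open_lt].
have [|al [/= al0 lal]] := @Baire R R^o _ D [set x : R | 0 < x] _ (@open_gt R 0).
  by exists 1; rewrite /= ltr01.
exists al; split=> // A; have [//|/=] := lal A I.
by rewrite ltNge (ltW al0).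
Qed.

(** If [p al = q], then [p |m - n al|] is a positive integer for all [m], [n] with
    [m <> n al], which contradicts approximation at rate [A = p]. *)
Lemma liouville_irrational (al : R) : (forall A, well_approximable A al) ->
  forall p q : nat, (0 < p)%N -> p%:R * al != q%:R.
Proof.
move=> lal p q p0; apply/eqP => pq.
have pR : 0 < p%:R :> R by rewrite ltr0n.
have alE : al = q%:R / p%:R by rewrite -pq mulrAC divff ?mul1r// gt_eqF.
have [m [n /andP[gt0 ltA]]] := lal p.
have key : p%:R * `|m%:R - n%:R * al| = `|(m * p)%:Z - (n * q)%:Z|%:~R.
  rewrite intr_norm rmorphB /= -!pmulrn !natrM -[X in X * _](ger0_norm (ltW pR)) -normrM.
  by rewrite alE; congr `|_|; field; rewrite gt_eqF.
have ge1 : 1 <= p%:R * `|m%:R - n%:R * al|.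
  have : 0 < p%:R * `|m%:R - n%:R * al| by rewrite mulr_gt0.
  by rewrite key ltr0z ler1z gtz0_ge1.
suff : p%:R * `|m%:R - n%:R * al| < 1 by rewrite ltNge ge1.
apply: (@lt_trans _ _ (p%:R * expR (- (p%:R * (m + n).+1%:R)))).
  by rewrite ltr_pM2l.
rewrite expRN ltr_pdivrMr ?expR_gt0// mul1r.
apply: lt_le_trans (expR_ge1Dx _).
have : p%:R <= p%:R * (m + n).+1%:R :> R by rewrite ler_peMr ?ler1n// ltW.
by move=> ?; lra.
Qed.
End Liouville.

(** * Maps preserving Lebesgue measure *)

Section ProductSigmaFinite.
Context d1 d2 (T1 : measurableType d1) (T2 : measurableType d2) (R : realType).
Variables (m1 : {sigma_finite_measure set T1 -> \bar R})
          (m2 : {sigma_finite_measure set T2 -> \bar R}).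

Lemma product_sigma_finite : sigma_finite setT (m1 \x m2)%E.
Proof.
have /sigma_finiteP[F [TF ndF Foo]] := sigma_finiteT m1.
have /sigma_finiteP[H [TH ndH Hoo]] := sigma_finiteT m2.
exists (fun n => F n `*` H n).
  apply/esym; rewrite -subTset => -[x y] _.
  have : setT x by [].
  rewrite TF => -[n _ Fx].
  have : setT y by [].
  rewrite TH => -[k _ Hy].
  exists (maxn n k) => //; split => /=.
    by move: x Fx; exact/subsetPset/ndF/leq_maxl.
  by move: y Hy; exact/subsetPset/ndH/leq_maxr.
move=> k; have [? ?] := Foo k; have [? ?] := Hoo k.
split; first exact: measurableX.
by rewrite product_measure1E// lte_mul_pinfty// ge0_fin_numE.
Qed.

Let product_measure_mixin := Measure_isSigmaFinite.Build _ _ _ (m1 \x m2)%E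
  product_sigma_finite.

(** The product measure together with its sigma-finiteness, so that products can
    be iterated. *)
Definition product_measure : {sigma_finite_measure set (T1 * T2)%type -> \bar R} :=
  HB.pack (m1 \x m2)%E product_measure_mixin.
End ProductSigmaFinite.

Section MeasurePreserving.
Context {R : realType}.

Definition preserves d (T : measurableType d) (m : set T -> \bar R) (F : T -> T) :=
  measurable_fun setT F /\ forall A, measurable A -> m (F @^-1` A) = m A.

Lemma preserves_shift (c : R) :
  preserves (@lebesgue_measure R) (fun x : measurableTypeR R => x + c).
Proof.
have mf : measurable_fun setT (fun x : measurableTypeR R => x + c).
  exact: measurable_funD.
split=> // A mA.
apply/esym; rewrite -[RHS]/(pushforward lebesgue_measure _ A).
apply: lebesgue_measure_unique => //= _ [[a b]] _ <-.
rewrite /pushforward /=.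
have -> : (fun x : R => x + c) @^-1` `]a, b] = `]a - c, b - c]%classic.
  by apply/seteqP; split=> x; rewrite /= !in_itv/= ltrBlDr lerBrDr.
rewrite !lebesgue_measure_itv/= !lte_fin ltrD2r -!EFinB.
by congr (if _ then _%:E else _); ring.
Qed.

Section Skew.
Context d1 d2 (T1 : measurableType d1) (T2 : measurableType d2).
Variables (m1 : {sigma_finite_measure set T1 -> \bar R})
          (m2 : {sigma_finite_measure set T2 -> \bar R}).
Local Open Scope ereal_scope.

(** The integral over the first factor of the measures of the sections is
    unchanged when each section is moved by a measure-preserving map, and when
    the base point is. *)
Lemma preserves_skew (F : T1 -> T1) (S : T1 * T2 -> T2) :
  preserves m1 F -> measurable_fun setT S ->
  (forall u, preserves m2 (fun v => S (u, v))) ->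
  preserves (m1 \x m2) (fun p => (F p.1, S p)).
Proof.
move=> [mF presF] mS presS.
have mFS : measurable_fun setT (fun p : T1 * T2 => (F p.1, S p)).
  by apply: measurable_fun_pair => //; exact: (measurableT_comp mF measurable_fst).
split=> // A mA; rewrite /product_measure1.
transitivity (\int[m1]_u ((m2 \o xsection A) \o F) u).
  apply: eq_integral => u _ /=.
  rewrite -[RHS](presS u).2; last exact: measurable_xsection.
  by congr (m2 _); apply/seteqP; split=> v; rewrite /xsection/= !inE.
rewrite -[LHS](@ge0_integral_pushforward _ _ _ _ _ _ mF m1 setT)//; last first.
  exact: measurable_fun_xsection.
by apply: eq_measure_integral => B mB _; exact: presF.
Qed.
End Skew.
End MeasurePreserving.

(** * Transport of measures along parametrizations *)

Section Parametrization.
Context {R : realType}.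

Definition borel_map d (M : measurableType d) (T : topologicalType) (f : M -> T) :=
  forall U, open U -> measurable (f @^-1` U).

(** What is needed for the image of [m] under [f] to be finite on compact sets
    and positive on nonempty open sets.  The domain carries the measure and the
    codomain the topology, so that Lebesgue measure and the topology of the line
    can be combined without giving both structures to one type. *)
Definition radon_map d (M : measurableType d) (m : set M -> \bar R)
    (T : topologicalType) (f : M -> T) :=
  (forall K, compact K ->
    exists A, [/\ measurable A, f @^-1` K `<=` A & (m A < +oo)%E]) /\
  (forall U, open U -> U !=set0 -> (0 < m (f @^-1` U))%E).

Lemma borel_map_real : borel_map (fun x : measurableTypeR R => x : R).
Proof. by move=> U; exact: open_measurable. Qed.

Lemma radon_map_real :
  radon_map (@lebesgue_measure R) (fun x : measurableTypeR R => x : R).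
Proof.
split=> [K /compact_bounded [M [_ MK]]|U oU [x Ux]].
  exists `[- (M + 1), M + 1]%classic; split=> //.
  - by move=> x Kx; rewrite /= in_itv/= -ler_norml; apply: MK => //; rewrite ltrDl.
  - by rewrite /= lebesgue_measure_itv/=; case: ifP; rewrite ?ltry.
have := oU; rewrite openE => /(_ x Ux); rewrite /interior -nbhs_ballE.
move=> -[e /= e0 eU].
have : (lebesgue_measure (ball x e) <= lebesgue_measure U)%E.
  apply: le_measure => //; apply/mem_set; apply: open_measurable => //.
  exact: ball_open.
apply: lt_le_trans; rewrite lebesgue_measure_ball ?ltW// lte_fin.
by rewrite mulrn_wgt0.
Qed.

Section Prod.
Context d1 d2 (M1 : measurableType d1) (M2 : measurableType d2).
Context (T1 T2 : topologicalType) (f1 : M1 -> T1) (f2 : M2 -> T2).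
Let f (p : M1 * M2) := (f1 p.1, f2 p.2).

(** An open set of the product is a union of countably many boxes taken from
    the two bases, and the preimages of boxes are measurable. *)
Lemma borel_map_prod : @second_countable T1 -> @second_countable T2 ->
  borel_map f1 -> borel_map f2 -> borel_map f.
Proof.
move=> [B1 cB1 [oB1 bB1]] [B2 cB2 [oB2 bB2]] bf1 bf2 U oU.
pose I := [set bc : set T1 * set T2 | [/\ B1 bc.1, B2 bc.2 & bc.1 `*` bc.2 `<=` U]].
have -> : f @^-1` U = \bigcup_(bc in I) ((f1 @^-1` bc.1) `*` (f2 @^-1` bc.2)).
  apply/seteqP; split=> [[x y] Uxy|[x y] [[b c] [/= _ _ bcU] [/= bx cy]]]; last first.
    exact: bcU.
  have := oU; rewrite openE => /(_ _ Uxy) [[P Q] [/= Px Qy] PQU].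
  have [b [Bb bx] bP] := bB1 _ _ Px; have [c [Cc cy] cQ] := bB2 _ _ Qy.
  exists (b, c) => //; split=> // -[u v] [/= bu cv].
  by apply: PQU; split; [exact: bP|exact: cQ].
rewrite bigcup_set_type; apply: countable_bigcupT_measurable.
  rewrite (eq_countable (card_setT I)).
  by apply: (sub_countable _ (countableX cB1 cB2)); apply: subset_card_le => -[b c] [].
move=> [[b c] /= /set_mem [/= /oB1 ob /oB2 oc _]].
by apply: measurableX; [exact: bf1|exact: bf2].
Qed.

Variables (m1 : {sigma_finite_measure set M1 -> \bar R})
          (m2 : {sigma_finite_measure set M2 -> \bar R}).

Lemma radon_map_prod : borel_map f1 -> borel_map f2 -> borel_map f ->
  radon_map m1 f1 -> radon_map m2 f2 -> radon_map (m1 \x m2)%E f.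
Proof.
move=> bf1 bf2 bf [K1 U1] [K2 U2]; split=> [K cK|U oU [[x y] Uxy]].
  have c1 : compact (fst @` K).
    by apply: continuous_compact => //; apply: continuous_subspaceT => p; exact: cvg_fst.
  have c2 : compact (snd @` K).
    by apply: continuous_compact => //; apply: continuous_subspaceT => p; exact: cvg_snd.
  have [A [mA KA Aoo]] := K1 _ c1; have [B [mB KB Boo]] := K2 _ c2.
  exists (A `*` B); split; first exact: measurableX.
    move=> [u v] /= Kuv; split; [apply: KA|apply: KB].
      by exists (f1 u, f2 v).
    by exists (f1 u, f2 v).
  by rewrite product_measure1E// lte_mul_pinfty// ge0_fin_numE.
have := oU; rewrite openE => /(_ _ Uxy) [[P Q] [/=]].
rewrite nbhsE => -[P' [oP Px] PP]; rewrite nbhsE => -[Q' [oQ Qy] QQ] PQU.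
have : ((m1 \x m2) ((f1 @^-1` P') `*` (f2 @^-1` Q')) <= (m1 \x m2) (f @^-1` U))%E.
  apply: le_measure.
  - by apply/mem_set; apply: measurableX; [exact: (bf1 _ oP)|exact: (bf2 _ oQ)].
  - apply/mem_set; exact: (bf _ oU).
  - by move=> [u v] [/= /PP Pu /QQ Qv]; apply: PQU.
apply: lt_le_trans; rewrite product_measure1E; [|exact: (bf1 _ oP)|exact: (bf2 _ oQ)].
by apply: mule_gt0; [apply: U1 => //; exists x|apply: U2 => //; exists y].
Qed.
End Prod.
End Parametrization.

(** * Haar measure on pairs of elements *)

Section Haar.
Context {R : realType} (al : R).
Local Notation G := (heis al).
Local Notation RM := (measurableTypeR R).
Local Notation M4 := ((RM * RM) * (RM * RM))%type.
Local Notation T4 := ((R * R) * (R * R))%type.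
Local Notation leb := (@lebesgue_measure R).

Definition leb2 : {sigma_finite_measure set (RM * RM)%type -> \bar R} :=
  product_measure leb leb.
Definition leb4 : {sigma_finite_measure set M4 -> \bar R} :=
  product_measure leb2 leb2.

(** The product of [(t, 0, 0, 0)] by [(0, x, y, z)], in this order: a left
    translation then moves [(x, y, z)] by a Heisenberg translation that depends
    on [t], with no dilation factor. *)
Definition heis_param (p : T4) : G :=
  vec4 p.1.1 (expR p.1.1 * p.1.2) (expR (al * p.1.1) * p.2.1)
    (expR p.1.1 * expR (al * p.1.1) * p.2.2).

Definition heis_param_inv (g : G) : T4 :=
  ((ct g, expR (- ct g) * cx g),
   (expR (- (al * ct g)) * cy g, expR (- ct g) * expR (- (al * ct g)) * cz g)).

Lemma heis_param_invK : cancel heis_param_inv heis_param.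
Proof.
move=> g; apply: row4P; rewrite /heis_param /heis_param_inv !vec4E /= ?expRN;
  field; rewrite ?expR_neq0 //.
Qed.

Lemma heis_paramK : cancel heis_param heis_param_inv.
Proof.
move=> [[t x] [y z]]; rewrite /heis_param_inv /heis_param !vec4E /= !expRN.
by congr (_, _, (_, _)); field; rewrite ?expR_neq0.
Qed.

(** Left translation by [h], read through [heis_param]. *)
Definition param_translation (h : G) (p : T4) : T4 :=
  let q := heis_param_inv h in
  ((p.1.1 + q.1.1, p.1.2 + q.1.2 * expR (- p.1.1)),
   (p.2.1 + q.2.1 * expR (- (al * p.1.1)),
    p.2.2 + (q.2.2 * (expR (- p.1.1) * expR (- (al * p.1.1)))
             + q.1.2 * expR (- p.1.1) * p.2.1))).

Lemma heis_param_translation h p :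
  heis_param (param_translation h p) = (h * heis_param p)%g.
Proof.
rewrite heis_mulE /heis_mul.
apply: row4P; rewrite /heis_param /param_translation /heis_param_inv !vec4E /=
  ?mulrDr ?expRD ?expRN; field; rewrite ?expR_neq0 //.
Qed.

Section Preserves.
Variable q : T4.

Let measD d (T : measurableType d) (f g : T -> RM) :
  measurable_fun setT f -> measurable_fun setT g ->
  measurable_fun setT (fun x => f x + g x : RM).
Proof. exact: measurable_funD. Qed.
Let measM d (T : measurableType d) (f g : T -> RM) :
  measurable_fun setT f -> measurable_fun setT g ->
  measurable_fun setT (fun x => f x * g x : RM).
Proof. exact: measurable_funM. Qed.
Let measN d (T : measurableType d) (f : T -> RM) :
  measurable_fun setT f -> measurable_fun setT (fun x => - f x : RM).
Proof. exact: measurable_funN. Qed.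
Let measE d (T : measurableType d) (f : T -> RM) :
  measurable_fun setT f -> measurable_fun setT (fun x => expR (f x) : RM).
Proof. by move=> mf; apply: (measurableT_comp (@measurable_expR R) mf). Qed.
Let meas1 d (T : measurableType d) d' (T' : measurableType d') d''
    (T'' : measurableType d'') (f : T -> T' * T'') :
  measurable_fun setT f -> measurable_fun setT (fun x => (f x).1).
Proof. by move=> mf; apply: (measurableT_comp measurable_fst mf). Qed.
Let meas2 d (T : measurableType d) d' (T' : measurableType d') d''
    (T'' : measurableType d'') (f : T -> T' * T'') :
  measurable_fun setT f -> measurable_fun setT (fun x => (f x).2).
Proof. by move=> mf; apply: (measurableT_comp measurable_snd mf). Qed.

Ltac meas := repeat first [ exact: measurable_id | exact: measurable_cst
  | apply: measurable_fun_pair | apply: measD | apply: measM | apply: measN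
  | apply: measE | apply: meas1 | apply: meas2 ].

Let shear1 (u : RM * RM) : RM * RM :=
  (u.1 + q.1.1, u.2 + q.1.2 * expR (- u.1)).
Let shear2 (p : M4) : RM * RM :=
  (p.2.1 + q.2.1 * expR (- (al * p.1.1)),
   p.2.2 + (q.2.2 * (expR (- p.1.1) * expR (- (al * p.1.1)))
             + q.1.2 * expR (- p.1.1) * p.2.1)).

Let shear1_preserves : preserves leb2 shear1.
Proof.
apply: (preserves_skew (m1 := leb) (m2 := leb) (F := fun t : RM => t + q.1.1)
  (S := fun p : RM * RM => p.2 + q.1.2 * expR (- p.1))).
- exact: preserves_shift.
- meas.
- by move=> u; exact: (preserves_shift (q.1.2 * expR (- u))).
Qed.

Let shear2_preserves u : preserves leb2 (fun v => shear2 (u, v)).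
Proof.
apply: (preserves_skew (m1 := leb) (m2 := leb)
  (F := fun y : RM => y + q.2.1 * expR (- (al * u.1)))
  (S := fun v : RM * RM => v.2 + (q.2.2 * (expR (- u.1) * expR (- (al * u.1)))
             + q.1.2 * expR (- u.1) * v.1))).
- exact: preserves_shift.
- meas.
- move=> y; exact: (preserves_shift (q.2.2 * (expR (- u.1) * expR (- (al * u.1)))
             + q.1.2 * expR (- u.1) * y)).
Qed.

Lemma shear_preserves : preserves leb4 (fun p : M4 => (shear1 p.1, shear2 p)).
Proof.
have mS : measurable_fun setT shear2.
  apply: measurable_fun_pair; meas.
exact: (preserves_skew shear1_preserves mS shear2_preserves).
Qed.
End Preserves.

Lemma param_translation_preserves h : preserves leb4 (param_translation h : M4 -> M4).
Proof. exact: shear_preserves. Qed.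

Lemma heis_param_continuous : continuous heis_param.
Proof.
pose t (p : T4) : R := p.1.1; pose x (p : T4) : R := p.1.2.
pose y (p : T4) : R := p.2.1; pose z (p : T4) : R := p.2.2.
have ct_ : continuous t.
  by move=> p; apply: (@continuous_comp _ _ _ fst fst); exact: cvg_fst.
have cx_ : continuous x.
  by move=> p; apply: (@continuous_comp _ _ _ fst snd); [exact: cvg_fst|exact: cvg_snd].
have cy_ : continuous y.
  by move=> p; apply: (@continuous_comp _ _ _ snd fst); [exact: cvg_snd|exact: cvg_fst].
have cz_ : continuous z.
  by move=> p; apply: (@continuous_comp _ _ _ snd snd); exact: cvg_snd.
have ce : continuous (fun p => expR (t p)).
  by move=> p; apply: (continuous_comp (ct_ p)); exact: continuous_expR.
have cal : continuous (fun p => expR (al * t p)).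
  move=> p; apply: (continuous_comp (f := fun p => al * t p) (g := expR)).
    by apply: cvgM; [exact: cvg_cst|exact: ct_].
  exact: continuous_expR.
apply: vec4_continuous => // p.
- by apply: cvgM; [exact: ce|exact: cx_].
- by apply: cvgM; [exact: cal|exact: cy_].
- by apply: cvgM; [apply: cvgM; [exact: ce|exact: cal]|exact: cz_].
Qed.

Lemma heis_param_inv_continuous : continuous heis_param_inv.
Proof.
have ce : continuous (fun g : 'rV[R]_4 => expR (- ct g)).
  move=> g; apply: (continuous_comp (f := fun g : 'rV[R]_4 => - ct g) (g := expR)).
    by apply: continuousN; exact: ct_continuous.
  exact: continuous_expR.
have cal : continuous (fun g : 'rV[R]_4 => expR (- (al * ct g))).
  move=> g; apply: (continuous_comp (f := fun g : 'rV[R]_4 => - (al * ct g)) (g := expR)).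
    apply: continuousN; apply: continuousM; [exact: cst_continuous|exact: ct_continuous].
  exact: continuous_expR.
have h1 : continuous (fun g : 'rV[R]_4 => expR (- ct g) * cx g).
  move=> g; exact: (cvgM (ce g) (@cx_continuous R g)).
have h2 : continuous (fun g : 'rV[R]_4 => expR (- (al * ct g)) * cy g).
  move=> g; exact: (cvgM (cal g) (@cy_continuous R g)).
have h3 : continuous (fun g : 'rV[R]_4 => expR (- ct g) * expR (- (al * ct g)) * cz g).
  move=> g; exact: (cvgM (cvgM (ce g) (cal g)) (@cz_continuous R g)).
move=> g.
exact: (cvg_pair (cvg_pair (@ct_continuous R g) (h1 g)) (cvg_pair (h2 g) (h3 g))).
Qed.

Lemma ptws_continuous (T V : topologicalType) (I : eqType) (f : T -> {ptws I -> V}) :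
  (forall i, continuous (fun x => f x i)) -> continuous f.
Proof.
move=> cf x; apply/cvg_sup => i A /= [B [[C oC <-] Cx] BA].
by apply: filterS BA _; apply: (cf i x); exact: open_nbhs_nbhs.
Qed.
End Haar.

Section HaarPair.
Context {R : realType} (al : R).
Local Notation G := (heis al).
Local Notation RM := (measurableTypeR R).
Local Notation M4 := ((RM * RM) * (RM * RM))%type.
Local Notation M8 := (M4 * M4)%type.
Local Notation T4 := ((R * R) * (R * R))%type.
Local Notation T8 := (T4 * T4)%type.

Definition leb8 : {sigma_finite_measure set M8 -> \bar R} :=
  product_measure (leb4 (R:=R)) (leb4 (R:=R)).

Let eta2 (A B : Type) : (fun p : A * B => (p.1, p.2)) = id.
Proof. by apply/funext => -[]. Qed.

Let sc2 : @second_countable (R * R)%type.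
Proof. by apply: second_countable_prod; exact: second_countable_real. Qed.
Let sc4 : @second_countable T4.
Proof. exact: second_countable_prod. Qed.

Let borel2 : borel_map (fun p : RM * RM => p : R * R).
Proof.
have := borel_map_prod (@second_countable_real R) (@second_countable_real R)
  (@borel_map_real R) (@borel_map_real R).
by rewrite eta2.
Qed.
Let borel4 : borel_map (fun p : M4 => p : T4).
Proof. by have := borel_map_prod sc2 sc2 borel2 borel2; rewrite eta2. Qed.
Let borel8 : borel_map (fun p : M8 => p : T8).
Proof. by have := borel_map_prod sc4 sc4 borel4 borel4; rewrite eta2. Qed.

Let radon2 : radon_map (@leb2 R) (fun p : RM * RM => p : R * R).
Proof.
have := @radon_map_prod _ _ _ _ _ _ _ _ _ (@lebesgue_measure R) (@lebesgue_measure R)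
 (@borel_map_real R) (@borel_map_real R) _ (@radon_map_real R) (@radon_map_real R).
by rewrite eta2; apply; exact: borel2.
Qed.
Let radon4 : radon_map (@leb4 R) (fun p : M4 => p : T4).
Proof.
have := @radon_map_prod _ _ _ _ _ _ _ _ _ (@leb2 R) (@leb2 R)
 borel2 borel2 _ radon2 radon2.
by rewrite eta2; apply; exact: borel4.
Qed.
Let radon8 : radon_map leb8 (fun p : M8 => p : T8).
Proof.
have := @radon_map_prod _ _ _ _ _ _ _ _ _ (@leb4 R) (@leb4 R)
 borel4 borel4 _ radon4 radon4.
by rewrite eta2; apply; exact: borel8.
Qed.

Definition pair_param (q : T8) : gpow G 2 :=
  fun i => heis_param al (if i == ord0 then q.1 else q.2).

Definition pair_param_inv (x : gpow G 2) : T8 :=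
  (heis_param_inv (x ord0), heis_param_inv (x ord_max)).

Lemma gpow2P (x y : gpow G 2) : x ord0 = y ord0 -> x ord_max = y ord_max -> x = y.
Proof.
move=> h0 h1; apply/funext => -[[|[|//]] i].
  by rewrite (_ : Ordinal i = ord0)//; exact: val_inj.
by rewrite (_ : Ordinal i = ord_max)//; exact: val_inj.
Qed.

Lemma pair_paramK : cancel pair_param pair_param_inv.
Proof.
by move=> [p q]; rewrite /pair_param_inv /pair_param /= !heis_paramK.
Qed.

Lemma pair_param_invK : cancel pair_param_inv pair_param.
Proof. by move=> x; apply: gpow2P; rewrite /pair_param /= heis_param_invK. Qed.

Lemma pair_param_continuous : continuous pair_param.
Proof.
apply: (@ptws_continuous T8 G 'I_2 pair_param) => i; rewrite /pair_param.
case: (i == ord0) => p.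
  by apply: (@continuous_comp _ _ _ fst); [exact: cvg_fst|exact: heis_param_continuous].
by apply: (@continuous_comp _ _ _ snd); [exact: cvg_snd|exact: heis_param_continuous].
Qed.

Lemma gpow_proj_continuous (i : 'I_2) : continuous (fun x : gpow G 2 => x i).
Proof. exact: (@proj_continuous _ (fun=> G) i). Qed.

Lemma pair_param_inv_continuous : continuous pair_param_inv.
Proof.
have h (i : 'I_2) : continuous (fun x : gpow G 2 => heis_param_inv (x i)).
  move=> x; apply: (@continuous_comp _ _ _ (fun x : gpow G 2 => x i)).
    exact: gpow_proj_continuous.
  exact: heis_param_inv_continuous.
by move=> x; exact: (cvg_pair (h ord0 x) (h ord_max x)).
Qed.

(** The same map as [pair_param], between the types that carry the
    sigma-algebras. *)
Definition pair_map : M8 -> borel (gpow G 2) := pair_param.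

Lemma pair_map_measurable : measurable_fun setT pair_map.
Proof.
have h := @measurability _ _ M8 (borel (gpow G 2)) setT pair_map (@open (gpow G 2)).
apply: h; first by [].
move=> _ [U oU <-]; rewrite setTI.
apply: (borel8 (U := pair_param @^-1` U)).
by apply: open_comp oU => p _; exact: pair_param_continuous.
Qed.

Definition haar_pair : {measure set (borel (gpow G 2)) -> \bar R}.
Proof.
unshelve refine [the measure _ _ of pushforward leb8 pair_map].
exact: pair_map_measurable.
Defined.

Let measurable_pair_preimage (A : set (borel (gpow G 2))) :
  measurable A -> measurable (pair_map @^-1` A).
Proof.
by move=> mA; rewrite -[X in measurable X]setTI; exact: pair_map_measurable.
Qed.

Let pair_translation (h : gpow G 2) (q : M8) : M8 :=
  (param_translation (h ord0) q.1, param_translation (h ord_max) q.2).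

Let pair_translation_preserves h : preserves leb8 (pair_translation h).
Proof.
have pt g := param_translation_preserves (al := al) g.
have mS : measurable_fun setT (fun q : M8 => param_translation (h ord_max) q.2 : M4).
  exact: (measurableT_comp (pt (h ord_max)).1 measurable_snd).
exact: (preserves_skew (pt (h ord0)) mS (fun=> pt (h ord_max))).
Qed.

Let pair_translationE h q : pair_param (pair_translation h q) = (h * pair_param q)%g.
Proof. by apply: gpow2P; exact: heis_param_translation. Qed.

Lemma haar_pair_haar : haar_measure haar_pair.
Proof.
split=> [h A mA|K cK|U oU [x Ux]].
- have := (pair_translation_preserves (h^-1)%g).2 _ (measurable_pair_preimage mA).
  apply: etrans; congr (leb8 _); apply/seteqP; split=> q /=; rewrite /pair_map /=.
    by move=> [y Ay yE]; rewrite pair_translationE -yE mulgA mulVg mul1g.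
  rewrite pair_translationE => Aq; exists (h^-1 * pair_param q)%g => //.
  by rewrite mulgA mulgV mul1g.
- have hG : hausdorff_space (gpow G 2).
    by apply: (@hausdorff_product 'I_2 (fun=> G)) => _; exact: heis_hausdorff.
  have mK : measurable (K : set (borel (gpow G 2))).
    rewrite -[K]setCK; apply: measurableC; apply: sub_sigma_algebra.
    by apply: closed_openC; exact: (compact_closed hG cK).
  have cK' : compact (pair_param_inv @` K).
    apply: continuous_compact => //; apply: continuous_subspaceT.
    exact: pair_param_inv_continuous.
  have [A [mA KA Aoo]] := radon8.1 _ cK'.
  apply: le_lt_trans Aoo; apply: (@le_measure _ _ _ leb8 (pair_map @^-1` K)).
  + exact: (mem_set (measurable_pair_preimage mK)).
  + exact/mem_set.
  + by move=> q Kq; apply: KA; exists (pair_param q) => //; exact: pair_paramK.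
- apply: (radon8.2 (pair_param @^-1` U)).
    by apply: open_comp oU => p _; exact: pair_param_continuous.
  by exists (pair_param_inv x); rewrite /= pair_param_invK.
Qed.
End HaarPair.

(** * Short words close to the identity *)

Section Estimates.
Context {R : realType}.

(** The exponential lies above its tangent at the larger of the two points. *)
Lemma expR_dist_le (M u v : R) : u <= M -> v <= M ->
  `|expR u - expR v| <= `|u - v| * expR M.
Proof.
wlog uv : u v / u <= v => [h uM vM|_ vM].
  have [/h|/ltW/h] := leP u v; first exact.
  by rewrite distrC (distrC v); apply.
have e0 := expR_gt0 v.
have euv : expR u <= expR v by rewrite ler_expR.
have h : (1 + (u - v)) * expR v <= expR u.
  by rewrite -[u in leRHS](subrK v) expRD ler_pM2r// expR_ge1Dx.
rewrite distrC (distrC u) !ger0_norm ?subr_ge0//.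
apply: (@le_trans _ _ ((v - u) * expR v)); first by lra.
by rewrite ler_wpM2l ?subr_ge0// ler_expR.
Qed.

Lemma expR_dist_le1 (M u v : R) : u <= M -> v <= M ->
  `|expR u - expR v| <= expR M.
Proof.
rewrite -(ler_expR u) -(ler_expR v) => uM vM.
have u0 := expR_ge0 u; have v0 := expR_ge0 v.
by rewrite ler_norml; apply/andP; split; lra.
Qed.

Lemma powR_natX_inv (b : R) (N K n : nat) : 0 < b -> (0 < N <= K ^ n)%N ->
  expR (- (b * ln K%:R * n%:R)) <= N%:R `^ (- b).
Proof.
move=> b0 /andP[N0 NK].
have K0 : (0 < K ^ n)%N by exact: leq_trans NK.
have NR : 0 < N%:R :> R by rewrite ltr0n.
have KR : 0 < (K ^ n)%:R :> R by rewrite ltr0n.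
rewrite /powR gt_eqF// ler_expR mulNr lerN2.
have lnK : ln (K ^ n)%:R = n%:R * ln K%:R :> R.
  case: n K0 {NK KR} => [|n] K0; first by rewrite expn0 ln1 mul0r.
  have Kp : 0 < K%:R :> R by move: K0; rewrite expn_gt0 orbF ltr0n.
  by rewrite natrX lnXn// mulr_natl.
have : ln N%:R <= ln (K ^ n)%:R :> R by rewrite ler_ln ?posrE// ler_nat.
rewrite lnK => /(ler_wpM2l (ltW b0)) h; apply: le_trans h _.
by rewrite le_eqVlt; apply/orP; left; apply/eqP; ring.
Qed.
End Estimates.

Section NotDiophantine.
Context {R : realType} (al : R).
Hypothesis al0 : 0 < al.
Hypothesis al_liouville : forall A, well_approximable A al.
Local Notation G := (heis al).

Section Word.
Variables (g u : G).
Hypotheses (t0 : ct g != 0) (v0 : cx u * cy u != 0).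
Let X := expR (ct g).
Let Y := expR (al * ct g).
Let C := `|cx u * cy u| * `|X - Y| * `|ct g|.
Let tau := `|ct g| * (1 + al).
Let value p q := cx u * cy u * ((X ^+ p - Y ^+ q) * (Y ^+ p - X ^+ q) * (X - Y)).

Let XE n : X ^+ n = expR (n%:R * ct g). Proof. by rewrite expRM_natl. Qed.
Let YE n : Y ^+ n = expR (n%:R * al * ct g).
Proof. by rewrite -mulrA expRM_natl. Qed.

Let exp_neq (a b : R) : a != b -> expR (a * ct g) - expR (b * ct g) != 0.
Proof.
by move=> ab; rewrite subr_eq0 (inj_eq (@expR_inj R)) (inj_eq (mulIf t0)).
Qed.

Let XY_neq0 : X - Y != 0.
Proof.
rewrite /X /Y -{1}[ct g]mul1r exp_neq// eq_sym.
by have := liouville_irrational al_liouville 1 (ltn0Sn 0); rewrite mul1r.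
Qed.

Lemma word_value_neq0 p q : 0 < `|p%:R - q%:R * al| -> value p q != 0.
Proof.
move=> pq; rewrite /value !XE !YE.
apply: mulf_neq0 => //; apply: mulf_neq0 => //; apply: mulf_neq0.
  by rewrite exp_neq// -subr_eq0 -normr_gt0.
rewrite exp_neq//.
case: p pq => [|p] pq; last exact: liouville_irrational.
move: pq; case: q => [|q _]; first by rewrite mul0r subrr normr0 ltxx.
by rewrite mul0r eq_sym pnatr_eq0.
Qed.

Lemma word_constant_gt0 : 0 < C.
Proof. by rewrite /C !mulr_gt0// normr_gt0. Qed.

Lemma word_value_le p q :
  `|value p q| <= C * `|p%:R - q%:R * al| * expR (2 * tau * (p + q).+1%:R).
Proof.
pose m : R := (p + q).+1%:R.
have bound (a b : R) : 0 <= a -> 0 <= b -> a + b <= m ->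
    (a + b * al) * ct g <= tau * m.
  move=> a0 b0 abm.
  apply: (@le_trans _ _ ((a + b * al) * `|ct g|)).
    by rewrite ler_wpM2l ?ler_norm// addr_ge0// mulr_ge0// ltW.
  rewrite /tau -mulrA mulrC ler_wpM2l// mulrDl mul1r.
  have am : a <= m by apply: le_trans abm; rewrite lerDl.
  have bm : b <= m by apply: le_trans abm; rewrite lerDr.
  by rewrite lerD// mulrC ler_wpM2l// ltW.
have pm : p%:R <= m by rewrite /m ler_nat; lia.
have qm : q%:R <= m by rewrite /m ler_nat; lia.
have b1 n : n%:R <= m -> n%:R * ct g <= tau * m.
  by move=> nm; have := bound n%:R 0; rewrite mul0r !addr0; apply.
have b2 n : n%:R <= m -> n%:R * al * ct g <= tau * m.
  by move=> nm; have := bound 0 n%:R; rewrite !add0r; apply.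
rewrite /value !normrM !XE !YE.
have h1 : `|expR (p%:R * ct g) - expR (q%:R * al * ct g)| <=
    `|p%:R - q%:R * al| * `|ct g| * expR (tau * m).
  by rewrite -normrM mulrBl; apply: expR_dist_le; [exact: b1|exact: b2].
have h2 : `|expR (p%:R * al * ct g) - expR (q%:R * ct g)| <= expR (tau * m).
  by apply: expR_dist_le1; [exact: b2|exact: b1].
have := ler_pM (normr_ge0 _) (normr_ge0 _) h1 h2.
move=> /(ler_wpM2r (normr_ge0 (X - Y))) /(ler_wpM2l (normr_ge0 (cx u * cy u))).
rewrite normrM => h; apply: le_trans h _.
rewrite /C -/m [2 * tau * m](_ : _ = tau * m + tau * m); last by ring.
rewrite expRD normrM le_eqVlt; apply/orP; left; apply/eqP; ring.
Qed.

Lemma small_values (L c : R) : 0 < c -> exists p q,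
  0 < `|value p q| < c * expR (- (L * (p + q).+1%:R)).
Proof.
move=> c0.
(* The rate [A] absorbs the exponential growth in [word_value_le], the rate [L]
   and the constant [C / c]. *)
pose D := 2 * tau + L + `|ln (C / c)|.
have [A DA] : exists A : nat, D <= A%:R.
  exists (Num.bound `|D|); apply: le_trans (ler_norm D) _.
  by apply/ltW/archi_boundP; exact: normr_ge0.
have [p [q /andP[pq0 pqA]]] := al_liouville A; exists p, q.
rewrite normr_gt0 word_value_neq0//=.
apply: le_lt_trans (word_value_le p q) _.
set m : R := (p + q).+1%:R; have m1 : 1 <= m by rewrite ler1n.
apply: (@lt_le_trans _ _ (C * expR (- (A%:R * m)) * expR (2 * tau * m))).
  by rewrite ltr_pM2r ?expR_gt0// ltr_pM2l// word_constant_gt0.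
rewrite -[leLHS]mulrA -expRD.
have -> : C = c * expR (ln (C / c)).
  by rewrite lnK ?posrE ?divr_gt0 ?word_constant_gt0// mulrC divfK// gt_eqF.
rewrite -[leLHS]mulrA -expRD ler_pM2l// ler_expR.
have := ler_norm (ln (C / c)); have := normr_ge0 (ln (C / c)).
move: DA; rewrite /D; set l := ln _; set nl := `|_|; nra.
Qed.
End Word.

(** The pairs for which the words [small_word] are nontrivial as soon as
    [p <> q al]. *)
Definition generic_pairs : set (gpow G 2) := [set x |
  let u := comm (x ord0) (x ord_max) in ct (x ord0) * (cx u * cy u) != 0].

Lemma generic_not_beta_diophantine (beta : R) (x : gpow G 2) : 0 < beta ->
  generic_pairs x -> ~ beta_diophantine (heis_metric al) beta (range x).
Proof.
move=> b0; rewrite /generic_pairs /=; set u := comm _ _.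
rewrite mulf_eq0 negb_or => /andP[t0 v0] [c c0 H].
have u0 : ct u = 0 by exact: ct_comm.
have [p [q /andP[e0 eS]]] := small_values t0 v0 (80 * (beta * ln 5)) c0.
set e := _ * _ in e0 eS.
pose n := (80 * (p + q).+1)%N.
have wB : word_ball (range x) n (central al e).
  rewrite -small_wordE//; apply: small_word_ball.
    by apply: letter_ball; left; left; exists ord0.
  by apply: letter_ball; left; left; exists ord_max.
have w1 : central al e <> 1%g.
  move=> /(congr1 cz); rewrite heis_oneE !vec4E => e1.
  by move: e0; rewrite e1 normr0 ltxx.
have := H n isT.
apply/negP; rewrite -ltNge.
apply: (@le_lt_trans _ _ `|e|%:E).
  apply: le_trans (dist_central_le al e).
  by apply: ereal_inf_lbound; exists (central al e).
rewrite lte_fin; apply: lt_le_trans eS _; rewrite ler_pM2l//.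
apply: le_trans (powR_natX_inv b0 (card_word_ball x n)).
rewrite ler_expR lerN2 /n natrM le_eqVlt; apply/orP; left; apply/eqP.
by rewrite /=; ring.
Qed.

Lemma generic_open : open generic_pairs.
Proof.
pose pr (i : 'I_2) (x : gpow G 2) : 'rV[R]_4 := x i.
have prc i : continuous (pr i) by exact: gpow_proj_continuous.
have c1 (f : 'rV[R]_4 -> R) i : continuous f -> continuous (f \o pr i).
  by move=> cf x; apply: continuous_comp; [exact: prc|exact: cf].
pose F (k : R) (f : 'rV[R]_4 -> R) (x : gpow G 2) : R :=
  (1 - expR (k * ct (pr ord_max x))) * f (pr ord0 x)
  - (1 - expR (k * ct (pr ord0 x))) * f (pr ord_max x).
have cE k i : continuous (fun x => 1 - expR (k * ct (pr i x))).
  have ck : continuous (fun x => k * ct (pr i x)).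
    by move=> x; exact: (cvgM (cvg_cst k) (c1 ct i (@ct_continuous R) x)).
  have ce : continuous (fun x => expR (k * ct (pr i x))).
    by move=> x; apply: (continuous_comp (ck x)); exact: continuous_expR.
  by move=> x; exact: (cvgB (@cvg_cst R 1 _ _ _) (ce x)).
have cF k f : continuous f -> continuous (F k f).
  move=> cf x; exact: (cvgB (cvgM (cE k ord_max x) (c1 f ord0 cf x))
                            (cvgM (cE k ord0 x) (c1 f ord_max cf x))).
rewrite (_ : generic_pairs = (fun x => ct (pr ord0 x) * (F 1 cx x * F al cy x)) @^-1`
    [set y : R | y != 0]); last first.
  by apply/seteqP; split=> x; rewrite /generic_pairs /= cx_comm cy_comm /F !mul1r.
apply: open_comp; last exact: open_neq.
move=> x _; exact: (cvgM (c1 ct ord0 (@ct_continuous R) x)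
  (cvgM (cF 1 cx (@cx_continuous R) x) (cF al cy (@cy_continuous R) x))).
Qed.

Lemma generic_nonempty : generic_pairs !=set0.
Proof.
pose a : G := vec4 1 0 0 0; pose b : G := vec4 0 1 1 0.
exists (fun i : 'I_2 => if i == ord0 then a else b) => /=.
rewrite /generic_pairs /= cx_comm cy_comm /a /b !vec4E.
rewrite !(mulr0, mulr1, mul1r, sub0r, mulrNN).
have exp_neq1 (k : R) : 0 < k -> 1 - expR k != 0.
  by move=> k0; rewrite subr_eq0 lt_eqF// expR_gt1.
by rewrite mulf_neq0// exp_neq1.
Qed.

Lemma heis_not_diophantine : ~ diophantine (heis_metric al).
Proof.
move=> /(_ 2%N isT) [beta b0 /(_ _ (haar_pair_haar al)) [A [mA A0 PA]]].
have UA : generic_pairs `<=` A.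
  by move=> x Ux; apply: PA; exact: generic_not_beta_diophantine.
have mU : measurable (generic_pairs : set (borel (gpow G 2))).
  by apply: sub_sigma_algebra; exact: generic_open.
have [_ _ pos] := haar_pair_haar al.
have := pos _ generic_open generic_nonempty; rewrite ltNge => /negP; apply.
by rewrite -A0; apply: le_measure => //; apply/mem_set.
Qed.
End NotDiophantine.

Theorem proposition1p6 (R : realType) :
  exists (G : lieGroupType R) (g : riemannian_metric G),
    [/\ left_invariant g,
        connected [set: G],
        group_solvable G,
        ~ group_nilpotent G &
        ~ diophantine g].
Proof.
have [al [al0 al_approx]] := @exists_liouville R.
exists (heis al), (heis_metric al); split.
- exact: heis_metric_left_invariant.
- exact: heis_connected.
- exact: heis_solvable.
- exact: heis_not_nilpotent.
- exact: heis_not_diophantine.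
Qed.
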